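(* Let $k$ be a field of characteristic zero, $m,n\in\mathbb{N}^*\setminus\{1\}$, $d=(m,n)$, $q\in P_m(k)$, $\overline{q}\in P_n(k)$. Then there are the following group isomorphisms: \begin{enumerate} \item If $m\neq n$, then $\mathrm{Aut}_{\mathrm{Hopf}}(\mathrm{T}^{\sigma}_{n,m}(\overline{q},q))\cong k^*\times k^*$ for every $\sigma\in U_d(k)$; and if $m=n$ and $q\neq\overline{q}$, then $\mathrm{Aut}_{\mathrm{Hopf}}(\mathrm{T}^{\sigma}_{n,n}(\overline{q},q))\cong k^*\times k^*$ for every $\sigma\in U_n(k)$. \item If $m=n$, then for $\sigma\in U_n(k)$, $\mathrm{Aut}_{\mathrm{Hopf}}(\mathrm{T}^{\sigma}_{n,n}(q,q))\cong k^*\times k^*$ if $\sigma^2\neq 1$, and $\mathrm{Aut}_{\mathrm{Hopf}}(\mathrm{T}^{\sigma}_{n,n}(q,q))\cong (k^*\times k^* )\rtimes_\tau\mathbb{Z}_2$ if $\sigma^2=1$, where $\tau:\mathbb{Z}_2\to\mathrm{Aut}(k^*\times k^* )$ is given by $\tau(\overline{1})(a,b)=(b,a)$. \item If $m=n$, then $\mathrm{Aut}_{\mathrm{Hopf}}(\mathrm{Q}^1_n(q))\cong k^*$ if $n\geq 3$, and $\mathrm{Aut}_{\mathrm{Hopf}}(\mathrm{Q}^1_n(q))\cong k^*\rtimes_\kappa\mathbb{Z}_2$ if $n=2$, where $\kappa:\mathbb{Z}_2\to\mathrm{Aut}(k^* )$ is given by $\kappa(\overline{1})(a)=a^{-1}$.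 \end{enumerate} Here $k^*\times k^*$ carries componentwise multiplication.
   Context: $U_n(k)=\{\omega\in k:\omega^n=1\}$, $P_n(k)$ is the set of primitive $n$-th roots of unity in $k$, $(m,n)$ is the gcd; $\mathrm{Aut}_{\mathrm{Hopf}}(E)$ is the group of Hopf algebra automorphisms of $E$. For $\sigma\in U_d(k)$, $\mathrm{T}^{\sigma}_{n,m}(\overline{q},q)$ is the Hopf algebra generated by $h,x,H,X$ with relations $h^m=H^n=1$, $x^m=X^n=0$, $xh=qhx$, $XH=\overline{q}HX$, $xH=\sigma Hx$, $hX=\sigma Xh$, $xX=\sigma Xx$, $hH=Hh$, where $h,H$ are group-like, $\Delta(x)=x\otimes h+1\otimes x$, $\Delta(X)=X\otimes H+1\otimes X$, with antipode $S(h)=h^{m-1}$, $S(H)=H^{n-1}$, $S(x)=-q^{m-1}h^{m-1}x$, $S(X)=-\overline{q}^{\,n-1}H^{n-1}X$. For $q\in P_n(k)$, $\mathrm{Q}^{1}_n(q)$ is the Hopf algebra generated by $h,x,H,X$ with relations $h^n=H^n=1$, $x^n=X^n=0$, $xh=qhx$, $XH=q^{n-1}HX$, $xH=qHx$, $hX=qXh$, $xX-qXx=1-Hh$, $hH=Hh$, with $h,H$ group-like, $\Delta(x)=x\otimes h+1\otimes x$, $\Delta(X)=X\otimes H+1\otimes X$, and antipode $S(h)=h^{n-1}$, $S(H)=H^{n-1}$, $S(x)=-q^{n-1}h^{n-1}x$, $S(X)=-qH^{n-1}X$. *)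

(* Defs.v *)
(* Hopf algebras are given by generators and relations:
   the free algebra k<h,x,H,X> is modelled by formal finite linear combinations
   of words, the quotient by the two-sided ideal generated by the relators is
   handled as a setoid (congruence modulo the ideal), and E (x) E is modelled by
   formal combinations of pairs of words modulo I(x)F + F(x)I. *)
From HB Require Import structures.
From mathcomp Require Import all_boot all_order all_algebra.
Set Implicit Arguments. Unset Strict Implicit. Unset Printing Implicit Defensive.
Import Order.TTheory GRing.Theory Num.Theory.
Local Open Scope ring_scope.

Definition gen := 'I_4.
Definition gh : gen := @Ordinal 4 0 isT.
Definition gx : gen := @Ordinal 4 1 isT.
Definition gH : gen := @Ordinal 4 2 isT.
Definition gX : gen := @Ordinal 4 3 isT.
Definition word := seq gen.

Section FreeAlg.
Variable k : fieldType.

(* elements of the free algebra F = k<h,x,H,X> : formal sums of c * w *)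
Definition falg := seq (k * word).
(* elements of F (x) F : formal sums of c * (w1 (x) w2) *)
Definition ften := seq (k * word * word).

Definition coef (f : falg) (w : word) : k := \sum_(p <- f | p.2 == w) p.1.
Definition coef2 (u : ften) (w1 w2 : word) : k :=
  \sum_(p <- u | (p.1.2 == w1) && (p.2 == w2)) p.1.1.
Definition feq (f g : falg) : Prop := forall w, coef f w = coef g w.
Definition feq2 (u v : ften) : Prop := forall w1 w2, coef2 u w1 w2 = coef2 v w1 w2.

Definition fscale (c : k) (f : falg) : falg := [seq (c * p.1, p.2) | p <- f].
Definition fsub (f g : falg) : falg := f ++ fscale (-1) g.
Definition fmul (f g : falg) : falg := [seq (p.1 * r.1, p.2 ++ r.2) | p <- f, r <- g].
Definition fone : falg := [:: (1, [::])].
Definition fmon (c : k) (w : word) : falg := [:: (c, w)].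
Definition fgen (i : gen) : falg := [:: (1, [:: i])].

Definition ftens (f g : falg) : ften := [seq (p.1 * r.1, p.2, r.2) | p <- f, r <- g].
Definition fscale2 (c : k) (u : ften) : ften := [seq (c * p.1.1, p.1.2, p.2) | p <- u].
Definition fsub2 (u v : ften) : ften := u ++ fscale2 (-1) v.
Definition fmul2 (u v : ften) : ften :=
  [seq (p.1.1 * r.1.1, p.1.2 ++ r.1.2, p.2 ++ r.2) | p <- u, r <- v].
Definition fone2 : ften := [:: (1, [::], [::])].

Definition eval_word (img : gen -> falg) (w : word) : falg :=
  foldr (fun i acc => fmul (img i) acc) fone w.
Definition fmap (img : gen -> falg) (f : falg) : falg :=
  flatten [seq fscale p.1 (eval_word img p.2) | p <- f].
Definition eval_word2 (dimg : gen -> ften) (w : word) : ften :=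
  foldr (fun i acc => fmul2 (dimg i) acc) fone2 w.
Definition fdelta (dimg : gen -> ften) (f : falg) : ften :=
  flatten [seq fscale2 p.1 (eval_word2 dimg p.2) | p <- f].
Definition fmap2 (img : gen -> falg) (u : ften) : ften :=
  flatten [seq fscale2 p.1.1 (ftens (eval_word img p.1.2) (eval_word img p.2)) | p <- u].
Definition feps (eimg : gen -> k) (f : falg) : k :=
  \sum_(p <- f) p.1 * \prod_(i <- p.2) eimg i.

Definition in_ideal (R : seq falg) (f : falg) : Prop :=
  exists l : seq (falg * falg * falg),
    (forall t, t \in l -> t.1.2 \in R) /\
    feq f (flatten [seq fmul (fmul t.1.1 t.1.2) t.2 | t <- l]).

(* membership in I (x) F + F (x) I, the kernel of F (x) F -> E (x) E *)
Definition in_tideal (R : seq falg) (u : ften) : Prop :=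
  exists l : seq (falg * falg),
    (forall t, t \in l -> in_ideal R t.1 \/ in_ideal R t.2) /\
    feq2 u (flatten [seq ftens t.1 t.2 | t <- l]).

(* a bialgebra E = F / (R) presented by relators, with comultiplication and
   counit given on generators *)
Record pres_bialg := PresBialg {
  rels : seq falg;
  dgen : gen -> ften;
  egen : gen -> k }.

(* an algebra endomorphism of E, given by images of the generators (lifted to F) *)
Definition preserves_ideal (A : pres_bialg) (img : gen -> falg) : Prop :=
  forall f, in_ideal (rels A) f -> in_ideal (rels A) (fmap img f).

Definition is_hopf_end (A : pres_bialg) (img : gen -> falg) : Prop :=
  [/\ preserves_ideal A img,
      forall f, in_tideal (rels A)
        (fsub2 (fdelta (dgen A) (fmap img f)) (fmap2 img (fdelta (dgen A) f))) &
      forall f, feps (egen A) (fmap img f) = feps (egen A) f].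

(* Hopf automorphism: bijective Hopf (= bialgebra) endomorphism of E *)
Definition is_hopf_aut (A : pres_bialg) (img : gen -> falg) : Prop :=
  is_hopf_end A img /\
  exists img' : gen -> falg,
    [/\ preserves_ideal A img',
        forall i, in_ideal (rels A) (fsub (fmap img' (img i)) (fgen i)) &
        forall i, in_ideal (rels A) (fsub (fmap img (img' i)) (fgen i))].

Definition aut_eq (A : pres_bialg) (img1 img2 : gen -> falg) : Prop :=
  forall i, in_ideal (rels A) (fsub (img1 i) (img2 i)).
Definition aut_comp (img1 img2 : gen -> falg) : gen -> falg :=
  fun i => fmap img1 (img2 i).

Definition aut_group_iso (A : pres_bialg) (G : Type) (mulG : G -> G -> G) : Prop :=
  exists Phi : G -> gen -> falg,
    [/\ forall g, is_hopf_aut A (Phi g),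
        forall g g', aut_eq A (Phi (mulG g g')) (aut_comp (Phi g) (Phi g')),
        forall g g', aut_eq A (Phi g) (Phi g') -> g = g' &
        forall img, is_hopf_aut A img -> exists g, aut_eq A img (Phi g)].

Definition dgen_std (i : gen) : ften :=
  match val i with
  | 0%N => [:: (1, [:: gh], [:: gh])]
  | 1%N => [:: (1, [:: gx], [:: gh]); (1, [::], [:: gx])]
  | 2%N => [:: (1, [:: gH], [:: gH])]
  | _ => [:: (1, [:: gX], [:: gH]); (1, [::], [:: gX])]
  end.
Definition egen_std (i : gen) : k :=
  if (val i == 0%N) || (val i == 2%N) then 1 else 0.

Definition rels_T (sigma qb q : k) (n m : nat) : seq falg :=
  [:: fsub (fmon 1 (nseq m gh)) fone;
      fsub (fmon 1 (nseq n gH)) fone;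
      fmon 1 (nseq m gx);
      fmon 1 (nseq n gX);
      fsub (fmon 1 [:: gx; gh]) (fmon q [:: gh; gx]);
      fsub (fmon 1 [:: gX; gH]) (fmon qb [:: gH; gX]);
      fsub (fmon 1 [:: gx; gH]) (fmon sigma [:: gH; gx]);
      fsub (fmon 1 [:: gh; gX]) (fmon sigma [:: gX; gh]);
      fsub (fmon 1 [:: gx; gX]) (fmon sigma [:: gX; gx]);
      fsub (fmon 1 [:: gh; gH]) (fmon 1 [:: gH; gh])].
Definition T_alg (sigma : k) (n m : nat) (qb q : k) : pres_bialg :=
  PresBialg (rels_T sigma qb q n m) dgen_std egen_std.

Definition rels_Q (n : nat) (q : k) : seq falg :=
  [:: fsub (fmon 1 (nseq n gh)) fone;
      fsub (fmon 1 (nseq n gH)) fone;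
      fmon 1 (nseq n gx);
      fmon 1 (nseq n gX);
      fsub (fmon 1 [:: gx; gh]) (fmon q [:: gh; gx]);
      fsub (fmon 1 [:: gX; gH]) (fmon (q ^+ n.-1) [:: gH; gX]);
      fsub (fmon 1 [:: gx; gH]) (fmon q [:: gH; gx]);
      fsub (fmon 1 [:: gh; gX]) (fmon q [:: gX; gh]);
      fsub (fsub (fmon 1 [:: gx; gX]) (fmon q [:: gX; gx]))
           (fsub fone (fmon 1 [:: gH; gh]));
      fsub (fmon 1 [:: gh; gH]) (fmon 1 [:: gH; gh])].
Definition Q_alg (n : nat) (q : k) : pres_bialg :=
  PresBialg (rels_Q n q) dgen_std egen_std.

Definition kstar := {a : k | a != 0}.
Definition kmul (a b : kstar) : kstar :=
  exist _ (val a * val b) (mulf_neq0 (valP a) (valP b)).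
Definition kinv (a : kstar) : kstar := exist _ (val a)^-1 (invr_neq0 (valP a)).

Definition kk_mul (u v : kstar * kstar) : kstar * kstar :=
  (kmul u.1 v.1, kmul u.2 v.2).
Definition tau (s : bool) (u : kstar * kstar) : kstar * kstar :=
  if s then (u.2, u.1) else u.
Definition kkz_mul (u v : (kstar * kstar) * bool) : (kstar * kstar) * bool :=
  (kk_mul u.1 (tau u.2 v.1), addb u.2 v.2).
Definition kappa (s : bool) (a : kstar) : kstar := if s then kinv a else a.
Definition kz_mul (u v : kstar * bool) : kstar * bool :=
  (kmul u.1 (kappa u.2 v.1), addb u.2 v.2).

End FreeAlg.

(* Main.v *)
Require Import Defs.
From HB Require Import structures.
From mathcomp Require Import all_boot all_order all_algebra.
From mathcomp Require Import mxtens ring zify.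
Set Implicit Arguments. Unset Strict Implicit. Unset Printing Implicit Defensive.
Import Order.TTheory GRing.Theory Num.Theory.
Local Open Scope ring_scope.

(* Both families are quotients by xX - sigma Xx = lam (1 - Hh) together with
   q-commutation relations. The left regular representation on formal ordered
   monomials h^a H^b x^c X^d, a, c < m and b, d < n, satisfies the relations, so
   these monomials form a basis of the quotient. The comultiplication of an
   ordered monomial never uses the relation between x and X; by the q-binomial
   theorem it is a sum of tensors of ordered monomials with nonzero coefficients.
   Comparing coordinates, a group-like element is some h^a H^b, and a
   (1, g)-skew-primitive element is p (1 - g) + r x + s X with r = 0 unless g = h
   and s = 0 unless g = H. For an automorphism, the relation between the images
   of x and h (X and H) then kills p, so it either rescales x and X or also
   exchanges (h, x) with (H, X); the remaining relations decide which
   exchanges and which scalars occur. *)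

(** * Formal linear combinations of words *)

(** The quotient and its tensor square exist only as congruences on lists, so there is no algebra
    type in which to compute. Hence two translations: a formal combination is known through its
    linear extensions, and a congruence class through its value in a matrix algebra, with Kronecker
    products in the role of the tensor square. The tensor ideal enters asymmetrically: for an
    unknown automorphism, membership is evaluated in matrices; for the explicit maps, compatibility
    with the comultiplication holds already in the free algebra. The delicate point of the
    representation is the action of X: carrying X past x^c produces lower terms when [lam] is
    nonzero. Their coefficients are q-integers, which vanish at c = m because q has order m. As for
    the scalars, rescaling by r and s multiplies xX - sigma Xx by rs and fixes 1 - Hh, so rs = 1
    unless [lam = 0]. An exchange asks for q = qb and sigma = sigma^-1; in the second family, where
    sigma = q and qb = q^-1, both say q^2 = 1, that is, n = 2. *)

Section LinearExtension.
Variable k : fieldType.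
Implicit Types (f g : falg k) (u v : ften k) (L : lmodType k).

(** Each operation on formal combinations is described by its effect on [evl F] for arbitrary [F];
    identities up to [feq] then become identities between sums, and lists need no normal form. *)
Definition evl L (F : word -> L) f : L := \sum_(p <- f) p.1 *: F p.2.
Definition evl2 L (F : word -> word -> L) u : L :=
  \sum_(p <- u) p.1.1 *: F p.1.2 p.2.

Lemma eq_evl L (F G : word -> L) f : F =1 G -> evl F f = evl G f.
Proof. by move=> eFG; apply: eq_bigr => p _; rewrite eFG. Qed.

Lemma eq_evl2 L (F G : word -> word -> L) u : F =2 G -> evl2 F u = evl2 G u.
Proof. by move=> eFG; apply: eq_bigr => p _; rewrite eFG. Qed.

Lemma evl_cat L (F : word -> L) f g : evl F (f ++ g) = evl F f + evl F g.
Proof. exact: big_cat. Qed.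

Lemma evl_nil L (F : word -> L) : evl F [::] = 0.
Proof. exact: big_nil. Qed.

Lemma evl_cons L (F : word -> L) p f : evl F (p :: f) = p.1 *: F p.2 + evl F f.
Proof. exact: big_cons. Qed.

Lemma evl2_cat L (F : word -> word -> L) u v : evl2 F (u ++ v) = evl2 F u + evl2 F v.
Proof. exact: big_cat. Qed.

Lemma evl_scale L (F : word -> L) c f : evl F (fscale c f) = c *: evl F f.
Proof.
by rewrite /evl big_map scaler_sumr; apply: eq_bigr => p _; rewrite scalerA.
Qed.

Lemma evl2_scale L (F : word -> word -> L) c u : evl2 F (fscale2 c u) = c *: evl2 F u.
Proof.
by rewrite /evl2 big_map scaler_sumr; apply: eq_bigr => p _; rewrite scalerA.
Qed.

Lemma evl_sub L (F : word -> L) f g : evl F (fsub f g) = evl F f - evl F g.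
Proof. by rewrite evl_cat evl_scale scaleN1r. Qed.

Lemma evl2_sub L (F : word -> word -> L) u v : evl2 F (fsub2 u v) = evl2 F u - evl2 F v.
Proof. by rewrite evl2_cat evl2_scale scaleN1r. Qed.

Lemma evl_flatten L (F : word -> L) (s : seq (falg k)) :
  evl F (flatten s) = \sum_(f <- s) evl F f.
Proof. by elim: s => [|f s IHs]; rewrite /= ?evl_nil ?big_nil // evl_cat IHs big_cons. Qed.

Lemma evl2_flatten L (F : word -> word -> L) (s : seq (ften k)) :
  evl2 F (flatten s) = \sum_(u <- s) evl2 F u.
Proof.
elim: s => [|u s IHs]; first by rewrite /= /evl2 !big_nil.
by rewrite /= evl2_cat IHs big_cons.
Qed.

Lemma evl_mul L (F : word -> L) f g :
  evl F (fmul f g) = evl (fun a => evl (fun b => F (a ++ b)) g) f.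
Proof.
rewrite /evl big_allpairs_dep; apply: eq_bigr => p _.
by rewrite scaler_sumr; apply: eq_bigr => r _; rewrite scalerA.
Qed.

Lemma evl2_tens L (F : word -> word -> L) f g :
  evl2 F (ftens f g) = evl (fun a => evl (F a) g) f.
Proof.
rewrite /evl2 big_allpairs_dep; apply: eq_bigr => p _.
by rewrite scaler_sumr; apply: eq_bigr => r _; rewrite scalerA.
Qed.

Lemma evl2_mul L (F : word -> word -> L) u v :
  evl2 F (fmul2 u v)
    = evl2 (fun a b => evl2 (fun c d => F (a ++ c) (b ++ d)) v) u.
Proof.
rewrite /evl2 big_allpairs_dep; apply: eq_bigr => p _.
by rewrite scaler_sumr; apply: eq_bigr => r _; rewrite scalerA.
Qed.

Lemma evl_fmap L (F : word -> L) img f :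
  evl F (fmap img f) = evl (fun w => evl F (eval_word img w)) f.
Proof. by rewrite evl_flatten big_map; apply: eq_bigr => p _; rewrite evl_scale. Qed.

Lemma evl2_fdelta L (F : word -> word -> L) dimg f :
  evl2 F (fdelta dimg f) = evl (fun w => evl2 F (eval_word2 dimg w)) f.
Proof. by rewrite evl2_flatten big_map; apply: eq_bigr => p _; rewrite evl2_scale. Qed.

Lemma evl2_fmap2 L (F : word -> word -> L) img u :
  evl2 F (fmap2 img u) =
  evl2 (fun a b => evl (fun c => evl (F c) (eval_word img b)) (eval_word img a)) u.
Proof.
by rewrite evl2_flatten big_map; apply: eq_bigr => p _; rewrite evl2_scale evl2_tens.
Qed.

Lemma evl_evl2 L (F : word -> word -> word -> L) f u :
  evl (fun w => evl2 (F w) u) f = evl2 (fun a b => evl (fun w => F w a b) f) u.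
Proof.
rewrite /evl /evl2.
under eq_bigr => p _ do rewrite scaler_sumr.
rewrite exchange_big /=; apply: eq_bigr => r _.
by rewrite scaler_sumr; apply: eq_bigr => p _; rewrite !scalerA mulrC.
Qed.

Lemma evl_evl L (F : word -> word -> L) f g :
  evl (fun w => evl (F w) g) f = evl (fun b => evl (F^~ b) f) g.
Proof.
rewrite /evl.
under eq_bigr => p _ do rewrite scaler_sumr.
rewrite exchange_big /=; apply: eq_bigr => r _.
by rewrite scaler_sumr; apply: eq_bigr => p _; rewrite !scalerA mulrC.
Qed.

Lemma evl_coef L (F : word -> L) f (s : seq word) :
  uniq s -> {subset [seq p.2 | p <- f] <= s} ->
  evl F f = \sum_(w <- s) coef f w *: F w.
Proof.
move=> us sub; rewrite /coef.
under [RHS]eq_bigr => w _ do rewrite scaler_suml big_mkcond.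
rewrite exchange_big /= /evl [LHS]big_seq [RHS]big_seq; apply: eq_bigr => p pf.
rewrite (bigD1_seq p.2) /= ?eqxx ?sub ?map_f //=.
by rewrite big1 ?addr0 // => w; rewrite eq_sym => /negPf->.
Qed.

Lemma feq_evl L (F : word -> L) f g : feq f g -> evl F f = evl F g.
Proof.
(* A duplicate-free list of words that covers both supports, so that the two sides become sums over
   the same index set. *)
move=> efg; pose s := undup [seq p.2 | p <- f ++ g].
have sub h : {subset h <= f ++ g} -> evl F h = \sum_(w <- s) coef h w *: F w.
  move=> hfg; apply: evl_coef; rewrite ?undup_uniq // => w /mapP[p ph ->].
  by rewrite mem_undup map_f ?hfg.
rewrite !sub; first by apply: eq_bigr => w _; rewrite efg.
- by move=> p pg; rewrite mem_cat pg orbT.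
- by move=> p pf; rewrite mem_cat pf.
Qed.

(** The indicator of a word, taken for [F], recovers the coefficient of that word. With [feq_evl]
    this makes [feq] the same as equality under all linear extensions. *)
Lemma evl_feq f g : (forall F : word -> k^o, evl F f = evl F g) -> feq f g.
Proof.
have coefE h w : coef h w = evl (fun a => (a == w)%:R : k^o) h.
  rewrite /coef big_mkcond; apply: eq_bigr => p _ /=.
  by case: eqP => _; rewrite /GRing.scale /= ?mulr1 ?mulr0.
by move=> efg w; rewrite !coefE efg.
Qed.

Lemma evl2_coef2 L (F : word -> word -> L) u (s : seq (word * word)) :
  uniq s -> {subset [seq (p.1.2, p.2) | p <- u] <= s} ->
  evl2 F u = \sum_(w <- s) coef2 u w.1 w.2 *: F w.1 w.2.
Proof.
move=> us sub; rewrite /coef2.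
under [RHS]eq_bigr => w _ do rewrite scaler_suml big_mkcond.
rewrite exchange_big /= /evl2 [LHS]big_seq [RHS]big_seq; apply: eq_bigr => p pu.
rewrite (bigD1_seq (p.1.2, p.2)) /= ?eqxx //.
  by rewrite big1 ?addr0 // => -[w1 w2] /=; rewrite eq_sym xpair_eqE => /negPf->.
by apply: sub; apply/mapP; exists p.
Qed.

Lemma feq2_evl2 L (F : word -> word -> L) u v : feq2 u v -> evl2 F u = evl2 F v.
Proof.
move=> euv; pose s := undup [seq (p.1.2, p.2) | p <- u ++ v].
have sub h : {subset h <= u ++ v} ->
    evl2 F h = \sum_(w <- s) coef2 h w.1 w.2 *: F w.1 w.2.
  move=> huv; apply: evl2_coef2; rewrite ?undup_uniq // => w /mapP[p ph ->].
  by rewrite mem_undup; apply/mapP; exists p => //; apply: huv.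
rewrite !sub; first by apply: eq_bigr => w _; rewrite euv.
- by move=> p pg; rewrite mem_cat pg orbT.
- by move=> p pf; rewrite mem_cat pf.
Qed.

Lemma evl2_feq2 u v : (forall F : word -> word -> k^o, evl2 F u = evl2 F v) -> feq2 u v.
Proof.
have coefE h w1 w2 :
    coef2 h w1 w2 = evl2 (fun a b => ((a == w1) && (b == w2))%:R : k^o) h.
  rewrite /coef2 big_mkcond; apply: eq_bigr => p _ /=.
  by case: ifP => _; rewrite /GRing.scale /= ?mulr1 ?mulr0.
by move=> euv w1 w2; rewrite !coefE euv.
Qed.

Lemma evl_eval_word_cat L (F : word -> L) img a b :
  evl F (eval_word img (a ++ b)) =
  evl (fun c => evl (fun d => F (c ++ d)) (eval_word img b)) (eval_word img a).
Proof.
elim: a F => [|i a IHa] F /=; first by rewrite /fone evl_cons evl_nil addr0 scale1r.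
by rewrite !evl_mul; apply: eq_evl => c; rewrite IHa; do 2!apply: eq_evl => ?; rewrite catA.
Qed.

Lemma evl2_eval_word2_cat L (F : word -> word -> L) dimg a b :
  evl2 F (eval_word2 dimg (a ++ b)) =
  evl2 (fun c1 c2 => evl2 (fun d1 d2 => F (c1 ++ d1) (c2 ++ d2))
                       (eval_word2 dimg b)) (eval_word2 dimg a).
Proof.
elim: a F => [|i a IHa] F /=.
  by rewrite /fone2 [RHS]/evl2 big_cons big_nil addr0 scale1r.
rewrite !evl2_mul; apply: eq_evl2 => c1 c2; rewrite IHa.
by do 2!apply: eq_evl2 => ? ?; rewrite !catA.
Qed.

(** Both sides are algebra morphisms from the free algebra to its tensor square, so agreement on
    generators suffices. The induction on words keeps [F] general, because each letter changes the
    functional. *)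
Lemma fdelta_fmap img dimg f :
  (forall i, feq2 (fdelta dimg (img i)) (fmap2 img (dimg i))) ->
  feq2 (fdelta dimg (fmap img f)) (fmap2 img (fdelta dimg f)).
Proof.
move=> Hgen; apply: evl2_feq2 => F.
rewrite evl2_fdelta evl_fmap evl2_fmap2 evl2_fdelta; apply: eq_evl => w.
elim: w F => [|i w IHw] F /=.
  rewrite /fone /fone2 evl_cons evl_nil addr0 scale1r /= /evl2 !big_cons !big_nil.
  by rewrite !addr0 !scale1r /= /fone !evl_cons !evl_nil !addr0 !scale1r.
rewrite evl_mul evl2_mul.
under eq_evl => a do under eq_evl => b do rewrite evl2_eval_word2_cat.
under eq_evl => a do rewrite evl_evl2.
under eq_evl => a do under eq_evl2 => c1 c2 do rewrite IHw.
(* The hypothesis on the generator [i], tested against the functional that has already absorbed the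
   tail [w]. *)
have := feq2_evl2 (fun c1 c2 => evl2 (fun a b => evl (fun c => evl
   (fun d => F (c1 ++ c) (c2 ++ d)) (eval_word img b)) (eval_word img a))
   (eval_word2 dimg w)) (Hgen i).
rewrite evl2_fdelta evl2_fmap2 => ->.
apply: eq_evl2 => a1 a2.
under eq_evl => c do rewrite evl_evl2.
rewrite evl_evl2; apply: eq_evl2 => b1 b2.
rewrite evl_eval_word_cat.
under [RHS]eq_evl => c do under eq_evl => d do rewrite evl_eval_word_cat.
by apply: eq_evl => c; rewrite evl_evl.
Qed.

End LinearExtension.

(** * The ideal generated by relators *)

Section Ideal.
Variables (k : fieldType) (R : seq (falg k)).
Implicit Types f g : falg k.

Lemma in_ideal_feq f g : feq f g -> in_ideal R f -> in_ideal R g.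
Proof. by move=> efg [l [lR El]]; exists l; split=> // w; rewrite -efg. Qed.

Lemma in_ideal_cat f g : in_ideal R f -> in_ideal R g -> in_ideal R (f ++ g).
Proof.
move=> [l [lR El]] [l' [lR' El']]; exists (l ++ l'); split.
  by move=> t; rewrite mem_cat => /orP[/lR|/lR'].
apply: evl_feq => F; rewrite map_cat flatten_cat !evl_cat.
by rewrite (feq_evl F El) (feq_evl F El').
Qed.

Lemma in_idealMl g f : in_ideal R f -> in_ideal R (fmul g f).
Proof.
move=> [l [lR El]]; exists [seq (fmul g t.1.1, t.1.2, t.2) | t <- l]; split.
  by move=> t /mapP[t' /lR t'R ->].
apply: evl_feq => F; rewrite evl_mul evl_flatten !big_map.
under eq_evl => a do rewrite (feq_evl _ El) evl_flatten big_map.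
rewrite [LHS]/evl /=; under eq_bigr => p _ do rewrite scaler_sumr.
rewrite exchange_big /=; apply: eq_bigr => t _.
rewrite !evl_mul; apply: eq_bigr => p _; rewrite !evl_mul; congr (_ *: _).
by do 3!apply: eq_evl => ?; rewrite !catA.
Qed.

Lemma in_idealMr g f : in_ideal R f -> in_ideal R (fmul f g).
Proof.
move=> [l [lR El]]; exists [seq (t.1.1, t.1.2, fmul t.2 g) | t <- l]; split.
  by move=> t /mapP[t' /lR t'R ->].
apply: evl_feq => F; rewrite evl_mul (feq_evl _ El) !evl_flatten !big_map.
apply: eq_bigr => t _; rewrite !evl_mul; apply: eq_evl => u.
apply: eq_evl => v; rewrite evl_mul; do 2!apply: eq_evl => ?.
by rewrite -!catA.
Qed.

End Ideal.

(** * Evaluation in an algebra *)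

Section Evaluation.
Variables (k : fieldType) (A : algType k).
Implicit Types (y : gen -> A) (f g : falg k).

Definition wv y (w : word) : A := \prod_(i <- w) y i.
Definition ev y f : A := evl (wv y) f.

Lemma wv_cat y a b : wv y (a ++ b) = wv y a * wv y b.
Proof. exact: big_cat. Qed.

Lemma wv_cons y i a : wv y (i :: a) = y i * wv y a.
Proof. exact: big_cons. Qed.

Lemma wv_nil y : wv y [::] = 1.
Proof. exact: big_nil. Qed.

Lemma wv_nseq y i j : wv y (nseq j i) = y i ^+ j.
Proof. by elim: j => [|j IHj]; rewrite /= ?wv_nil // wv_cons IHj exprS. Qed.

Lemma eq_ev y y' f : y =1 y' -> ev y f = ev y' f.
Proof. by move=> eyy'; apply: eq_evl => w; apply: eq_bigr => i _; rewrite eyy'. Qed.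

Lemma ev_cat y f g : ev y (f ++ g) = ev y f + ev y g.
Proof. exact: evl_cat. Qed.

Lemma ev_scale y c f : ev y (fscale c f) = c *: ev y f.
Proof. exact: evl_scale. Qed.

Lemma ev_sub y f g : ev y (fsub f g) = ev y f - ev y g.
Proof. exact: evl_sub. Qed.

Lemma ev_mon y c w : ev y (fmon c w) = c *: wv y w.
Proof. by rewrite /ev /fmon evl_cons evl_nil addr0. Qed.

Lemma ev_one y : ev y (fone k) = 1.
Proof. by rewrite -[fone k]/(fmon 1 [::]) ev_mon wv_nil scale1r. Qed.

Lemma ev_gen y i : ev y (fgen k i) = y i.
Proof. by rewrite -[fgen k i]/(fmon 1 [:: i]) ev_mon scale1r wv_cons wv_nil mulr1. Qed.

Lemma ev_mul y f g : ev y (fmul f g) = ev y f * ev y g.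
Proof.
rewrite /ev evl_mul /evl mulr_suml; apply: eq_bigr => p _.
rewrite -scalerAl mulr_sumr; congr (_ *: _); apply: eq_bigr => r _.
by rewrite wv_cat scalerAr.
Qed.

Lemma ev_eval_word y img w :
  ev y (eval_word img w) = wv (fun i => ev y (img i)) w.
Proof. by elim: w => [|i w IHw] /=; rewrite ?ev_one ?wv_nil // ev_mul IHw wv_cons. Qed.

Lemma ev_fmap y img f : ev y (fmap img f) = ev (fun i => ev y (img i)) f.
Proof. by rewrite /ev evl_fmap; apply: eq_evl => w; rewrite -ev_eval_word. Qed.

Lemma ev_feq y f g : feq f g -> ev y f = ev y g.
Proof. exact: feq_evl. Qed.

Lemma ev_in_ideal y (R : seq (falg k)) f :
  (forall r, r \in R -> ev y r = 0) -> in_ideal R f -> ev y f = 0.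
Proof.
move=> yR [l [lR El]]; rewrite (ev_feq y El) /ev evl_flatten big_map big_seq.
by apply: big1 => t /lR tR; rewrite -/(ev y _) !ev_mul (yR _ tR) mulr0 mul0r.
Qed.

Definition evE := (ev_sub, ev_scale, ev_mon, ev_one, wv_nseq, wv_cons, wv_nil,
  scale1r, mulr1).

End Evaluation.

(** * Evaluation in a tensor square *)

Section TensorEvaluation.
Variables (k : fieldType) (A A2 : algType k) (t : A -> A -> A2).
Hypothesis tDl : forall v, {morph t^~ v : u u' / u + u'}.
Hypothesis tDr : forall u, {morph t u : v v' / v + v'}.
Hypothesis tZl : forall c u v, t (c *: u) v = c *: t u v.
Hypothesis tZr : forall c u v, t u (c *: v) = c *: t u v.
Hypothesis tM : forall u v u' v', t u v * t u' v' = t (u * u') (v * v').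
Hypothesis t11 : t 1 1 = 1.
Implicit Types (y : gen -> A) (f g : falg k).

(** The map [t], bilinear, multiplicative and unital, stands for the pure tensor of two elements;
    the Kronecker product of matrices will instantiate it. *)
Definition evt y (u : ften k) : A2 := evl2 (fun a b => t (wv y a) (wv y b)) u.

Lemma t0l v : t 0 v = 0.
Proof. by rewrite -[0 in LHS](scale0r 0) tZl scale0r. Qed.

Lemma t0r u : t u 0 = 0.
Proof. by rewrite -[0 in LHS](scale0r 0) tZr scale0r. Qed.

Lemma tX u v j : t u v ^+ j = t (u ^+ j) (v ^+ j).
Proof. by elim: j => [|j IHj]; rewrite ?expr0 ?t11 // !exprS IHj tM. Qed.

Lemma evt_sub y u v : evt y (fsub2 u v) = evt y u - evt y v.
Proof. exact: evl2_sub. Qed.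

Lemma evt_tens y f g : evt y (ftens f g) = t (ev y f) (ev y g).
Proof.
rewrite /evt evl2_tens /ev /evl (big_morph (t^~ _) (tDl _) (t0l _)).
apply: eq_bigr => p _; rewrite tZl (big_morph _ (tDr _) (t0r _)).
by congr (_ *: _); apply: eq_bigr => r _; rewrite tZr.
Qed.

Lemma evt_mul y u v : evt y (fmul2 u v) = evt y u * evt y v.
Proof.
rewrite /evt evl2_mul /evl2 mulr_suml; apply: eq_bigr => p _.
rewrite -scalerAl mulr_sumr; congr (_ *: _); apply: eq_bigr => r _.
by rewrite !wv_cat -tM scalerAr.
Qed.

Lemma evt_fdelta y dimg f :
  evt y (fdelta dimg f) = ev (fun i => evt y (dimg i)) f.
Proof.
rewrite /evt evl2_fdelta; apply: eq_evl => w; elim: w => [|i w IHw] /=.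
  by rewrite /fone2 /evl2 big_cons big_nil addr0 scale1r !wv_nil t11.
by rewrite wv_cons -IHw -/(evt y _) evt_mul.
Qed.

Lemma evt_fmap2 y img u : evt y (fmap2 img u) = evt (fun i => ev y (img i)) u.
Proof.
rewrite /evt evl2_fmap2; apply: eq_evl2 => a b.
by rewrite -evl2_tens -/(evt y _) evt_tens !ev_eval_word.
Qed.

Lemma evt_in_tideal y (R : seq (falg k)) u :
  (forall r, r \in R -> ev y r = 0) -> in_tideal R u -> evt y u = 0.
Proof.
move=> yR [l [lR El]]; rewrite /evt (feq2_evl2 _ El) evl2_flatten big_map big_seq.
apply: big1 => p /lR pR; rewrite -/(evt y _) evt_tens.
by case: pR => /(ev_in_ideal yR) ->; rewrite ?t0l ?t0r.
Qed.

End TensorEvaluation.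

(** * Gaussian binomials *)

Section QBinomial.
Variables (k : fieldType) (q : k).

(** The q-integer [j]_q. *)
Definition qnat j : k := \sum_(i < j) q ^+ i.

(** The Gaussian binomial through the q-Pascal rule, which stays meaningful at roots of unity, where
    quotients of q-factorials may be 0/0. *)
Fixpoint qbin n i {struct n} : k :=
  match n, i with
  | _, 0%N => 1
  | 0%N, _.+1 => 0
  | n'.+1, i'.+1 => qbin n' i' + q ^+ i'.+1 * qbin n' i'.+1
  end.

Lemma qbin0 n : qbin n 0 = 1.
Proof. by case: n. Qed.

Lemma qbinS n i : qbin n.+1 i.+1 = qbin n i + q ^+ i.+1 * qbin n i.+1.
Proof. by []. Qed.

Lemma qbin_small n i : (n < i)%N -> qbin n i = 0.
Proof.
elim: n i => [|n IHn] [|i] //= lt_ni.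
by rewrite !IHn ?mulr0 ?addr0 // ltnW.
Qed.

Lemma qbinn n : qbin n n = 1.
Proof. by elim: n => //= n ->; rewrite qbin_small // mulr0 addr0. Qed.

Lemma qnatS j : qnat j.+1 = 1 + q * qnat j.
Proof.
rewrite /qnat big_ord_recl expr0 mulr_sumr; congr (_ + _).
by apply: eq_bigr => i _; rewrite -exprS.
Qed.

Lemma qnat_geom j : (1 - q) * qnat j = 1 - q ^+ j.
Proof.
elim: j => [|j IHj]; first by rewrite /qnat big_ord0 mulr0 expr0 subrr.
by rewrite /qnat big_ord_recr /= mulrDr -/(qnat j) IHj mulrBl mul1r -exprS addrA subrK.
Qed.

(** The q-analogue of (i+1) C(n+1,i+1) = (n+1) C(n,i). It replaces the factorial formula and gives
    both the vanishing in [qbin_prim] and the non-vanishing in [qbin_neq0]. *)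
Lemma qbin_absorb n i : qnat i.+1 * qbin n.+1 i.+1 = qnat n.+1 * qbin n i.
Proof.
elim: n i => [|n IHn] i.
  case: i => [|i]; first by rewrite /= mulr0 addr0.
  by rewrite /= !(mulr0, addr0).
rewrite [qbin n.+2 i.+1]qbinS mulrDr mulrCA IHn [qnat n.+2]qnatS qnatS !mulrDl !mul1r.
(* Once a unit is split off from the q-integers on both sides, what remains is the q-Pascal rule for
   [qbin n.+1 i] multiplied by [q * qnat n.+1]. *)
have <- : q * qnat i * qbin n.+1 i + q ^+ i.+1 * (qnat n.+1 * qbin n i)
          = q * qnat n.+1 * qbin n.+1 i; last by rewrite addrA.
case: i => [|i].
  by rewrite !qbin0 /qnat big_ord0 !(mulr0, mul0r) add0r expr1 !mulr1.
rewrite -mulrA IHn qbinS [q ^+ i.+2]exprS; ring.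
Qed.

Section Primitive.
Variable m : nat.
Hypotheses (Hm : (1 < m)%N) (Hq : m.-primitive_root q).

Lemma prim_neq1 : q != 1.
Proof.
apply: contraTneq Hm => q1; rewrite -leqNgt dvdn_leq //.
by rewrite (prim_order_dvd Hq) q1 expr1n.
Qed.

Lemma qnat_neq0 j : (0 < j < m)%N -> qnat j != 0.
Proof.
move=> /andP[j0 jm]; apply: contraTneq jm => j_0; rewrite -leqNgt dvdn_leq //.
by rewrite (prim_order_dvd Hq) eq_sym -subr_eq0 -qnat_geom j_0 mulr0.
Qed.

Lemma qnat_prim : qnat m = 0.
Proof.
have := qnat_geom m; rewrite prim_expr_order // subrr => /eqP.
by rewrite mulf_eq0 subr_eq0 eq_sym (negPf prim_neq1) => /eqP.
Qed.

Lemma qbin_prim i : (0 < i < m)%N -> qbin m i = 0.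
Proof.
case: i => // i im; have := qbin_absorb m.-1 i; rewrite prednK; last exact: ltnW.
by rewrite qnat_prim mul0r => /eqP; rewrite mulf_eq0 (negPf (qnat_neq0 im)) => /eqP.
Qed.

Lemma qbin_neq0 c i : (i <= c)%N -> (c < m)%N -> qbin c i != 0.
Proof.
elim: c i => [|c IHc] [|i] le_ic lt_cm //; rewrite ?qbin0 ?oner_eq0 //.
have : qnat c.+1 * qbin c i != 0 by rewrite mulf_neq0 ?qnat_neq0 // IHc // ltnW.
by rewrite -qbin_absorb mulf_eq0 => /norP[].
Qed.

End Primitive.
End QBinomial.

Arguments qbin : simpl never.

(** * Powers of q-commuting elements and the q-binomial theorem *)

Section QCommute.
Variables (k : fieldType) (A : algType k).
Implicit Types (u v : A) (z : k).

Lemma qcommX z u v c a :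
  v * u = z *: (u * v) -> v ^+ c * u ^+ a = z ^+ (c * a) *: (u ^+ a * v ^+ c).
Proof.
move=> vu; have vua : v * u ^+ a = z ^+ a *: (u ^+ a * v).
  elim: a => [|a IHa]; first by rewrite !expr0 mulr1 mul1r scale1r.
  by rewrite !exprS mulrA vu -scalerAl -[u * v * _]mulrA IHa -scalerAr scalerA mulrA.
elim: c => [|c IHc]; first by rewrite mul0n !expr0 mulr1 mul1r scale1r.
rewrite !(exprS v) -[v * _ * _]mulrA IHc -scalerAr [v * (_ * _)]mulrA vua -scalerAl scalerA.
by rewrite -exprD mulSn addnC mulrA.
Qed.

Lemma qbinomial z u v j : v * u = z *: (u * v) ->
  (u + v) ^+ j = \sum_(i < j.+1) qbin z j i *: (u ^+ i * v ^+ (j - i)).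
Proof.
move=> vu; elim: j => [|j IHj].
  by rewrite big_ord_recl big_ord0 addr0 /= !expr0 mulr1 scale1r.
have vi (i : nat) : v * (qbin z j i *: (u ^+ i * v ^+ (j - i)))
    = (z ^+ i * qbin z j i) *: (u ^+ i * v ^+ (j - i).+1).
  rewrite -scalerAr mulrA -{1}[v]expr1 (qcommX 1 i vu) mul1n -scalerAl scalerA mulrC.
  by rewrite -mulrA -exprD add1n.
rewrite exprS IHj mulrDl !mulr_sumr [RHS]big_ord_recl.
under [in RHS]eq_bigr => i _ do rewrite lift0 qbinS scalerDl subSS.
rewrite big_split addrCA; congr (_ + _).
  by apply: eq_bigr => i _; rewrite -scalerAr mulrA -exprS.
rewrite [in RHS]big_ord_recr [in LHS]big_ord_recl vi.
rewrite (qbin_small z (ltnSn j)) mulr0 scale0r /= addr0 !qbin0 expr0 mulr1 !subn0; congr (_ + _).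
by apply: eq_bigr => i _; rewrite vi ?lift0 /bump /= ?add1n subnSK.
Qed.

(** All inner Gaussian binomials vanish at a primitive root; this is why the comultiplication
    respects x^m = 0 and X^n = 0. *)
Lemma qbinomial_prim m z u v : (1 < m)%N -> m.-primitive_root z ->
  v * u = z *: (u * v) -> (u + v) ^+ m = u ^+ m + v ^+ m.
Proof.
case: m => // m m1 zm /(qbinomial m.+1)->.
rewrite big_ord_recl big_ord_recr /= qbin0 subn0.
rewrite big1 => [|i _].
  by rewrite add0r subnn qbinn !scale1r !expr0 mulr1 mul1r addrC.
by rewrite (qbin_prim m1 zm) ?scale0r //= ltnS.
Qed.

End QCommute.

(** * The defining relations and the comultiplication of ordered monomials *)

(* [lam = 0] gives T^sigma_{n,m}(qb, q); [lam = 1], [m = n], [sigma = q],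
   [qb = q^-1] gives Q^1_n(q). *)
Record qrel (k : fieldType) (m n : nat) (q qb sigma lam : k) (A : algType k)
    (y : gen -> A) : Prop := Qrel {
  qrel_hm : y gh ^+ m = 1;
  qrel_Hn : y gH ^+ n = 1;
  qrel_xm : y gx ^+ m = 0;
  qrel_Xn : y gX ^+ n = 0;
  qrel_xh : y gx * y gh = q *: (y gh * y gx);
  qrel_XH : y gX * y gH = qb *: (y gH * y gX);
  qrel_xH : y gx * y gH = sigma *: (y gH * y gx);
  qrel_hX : y gh * y gX = sigma *: (y gX * y gh);
  qrel_xX : y gx * y gX - sigma *: (y gX * y gx) = lam *: (1 - y gH * y gh);
  qrel_hH : y gh * y gH = y gH * y gh }.

Definition pbw (k : fieldType) (A : algType k) (y : gen -> A) a b c d : A :=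
  y gh ^+ a * y gH ^+ b * y gx ^+ c * y gX ^+ d.

Section Comultiplication.
Variables (k : fieldType) (m n : nat) (q qb sigma lam : k).
Hypotheses (Hm : (1 < m)%N) (Hn : (1 < n)%N).
Hypotheses (Hq : m.-primitive_root q) (Hqb : n.-primitive_root qb).
Variables (A A2 : algType k) (t : A -> A -> A2).
Hypothesis tDl : forall v, {morph t^~ v : u u' / u + u'}.
Hypothesis tDr : forall u, {morph t u : v v' / v + v'}.
Hypothesis tZl : forall c u v, t (c *: u) v = c *: t u v.
Hypothesis tZr : forall c u v, t u (c *: v) = c *: t u v.
Hypothesis tM : forall u v u' v', t u v * t u' v' = t (u * u') (v * v').
Hypothesis t11 : t 1 1 = 1.
Variable y : gen -> A.
Hypothesis yrel : qrel m n q qb sigma lam y.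

Let dy i := evt t y (dgen_std k i).
Let tX := tX tM t11.

Lemma dy_h : dy gh = t (y gh) (y gh).
Proof. by rewrite /dy /evt /evl2 big_cons big_nil addr0 scale1r !wv_cons !wv_nil !mulr1. Qed.

Lemma dy_H : dy gH = t (y gH) (y gH).
Proof. by rewrite /dy /evt /evl2 big_cons big_nil addr0 scale1r !wv_cons !wv_nil !mulr1. Qed.

Lemma dy_x : dy gx = t (y gx) (y gh) + t 1 (y gx).
Proof.
by rewrite /dy /evt /evl2 !big_cons big_nil addr0 !scale1r !wv_cons !wv_nil !mulr1.
Qed.

Lemma dy_X : dy gX = t (y gX) (y gH) + t 1 (y gX).
Proof.
by rewrite /dy /evt /evl2 !big_cons big_nil addr0 !scale1r !wv_cons !wv_nil !mulr1.
Qed.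

Let qcomm_x : t 1 (y gx) * t (y gx) (y gh) = q *: (t (y gx) (y gh) * t 1 (y gx)).
Proof. by rewrite !tM mul1r mulr1 (qrel_xh yrel) tZr. Qed.

Let qcomm_X : t 1 (y gX) * t (y gX) (y gH) = qb *: (t (y gX) (y gH) * t 1 (y gX)).
Proof. by rewrite !tM mul1r mulr1 (qrel_XH yrel) tZr. Qed.

(** The comultiplication descends to the quotient: [ev dy] is constant on congruence classes, so it
    may be computed after reduction to ordered monomials. *)
Lemma qrel_delta : qrel m n q qb sigma lam dy.
Proof.
have t0l := t0l tZl; have t0r := t0r tZr.
have t_sub u u' v : t (u - u') v = t u v - t u' v.
  by rewrite tDl -scaleN1r tZl scaleN1r.
have tsub u v v' : t u (v - v') = t u v - t u v'.
  by rewrite tDr -scaleN1r tZr scaleN1r.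
case: (yrel) => hm Hn' xm Xn xh XH xH hX xX hH.
split; rewrite ?(dy_h, dy_H, dy_x, dy_X).
- by rewrite tX hm t11.
- by rewrite tX Hn' t11.
- by rewrite (qbinomial_prim Hm Hq qcomm_x) !tX xm t0l t0r addr0.
- by rewrite (qbinomial_prim Hn Hqb qcomm_X) !tX Xn t0l t0r addr0.
- by rewrite mulrDl mulrDr !tM !mulr1 !mul1r xh tZl tZr scalerDr.
- by rewrite mulrDl mulrDr !tM !mulr1 !mul1r XH tZl tZr scalerDr.
- by rewrite mulrDl mulrDr !tM !mulr1 !mul1r xH tZl tZr scalerDr hH.
- by rewrite mulrDl mulrDr !tM !mulr1 !mul1r hX tZl tZr scalerDr hH.
- rewrite !(mulrDl, mulrDr) !tM !mulr1 !mul1r xH hX !tZr hH !scalerDr.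
  (* The mixed terms x (x) hX and X (x) xH cancel against their counterparts. The two remaining
     differences are both instances of the relation, and the right-hand sides telescope to [lam]
     times 1 (x) 1 - Hh (x) Hh. *)
  have -> (a b c d a' d' : A2) : a + b + (c + d) - (a' + c + (b + d')) = (a - a') + (d - d').
    apply/eqP; rewrite subr_eq; apply/eqP.
    rewrite [RHS]addrACA [_ - _ + _]addrA subrK [b + d']addrC [_ - _ + _]addrA subrK.
    by rewrite [d + b]addrC addrACA.
  rewrite -[X in _ - X + _]tZl -t_sub -tZr -tsub xX tZl tZr t_sub tsub t11.
  by rewrite -!scalerDr; congr (_ *: _); rewrite addrC addrA subrK.
- by rewrite !tM hH.
Qed.

(** The left legs come out ordered. In the right leg x^(c-i) has to pass H^j, which is the origin of
    the power of [sigma]. *)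
Lemma pbw_delta a b c d :
  pbw dy a b c d =
  \sum_(i < c.+1) \sum_(j < d.+1)
    (qbin q c i * qbin qb d j * sigma ^+ ((c - i) * j)) *:
      t (pbw y a b i j) (pbw y (a + i) (b + j) (c - i) (d - j)).
Proof.
rewrite /pbw dy_h dy_H dy_x dy_X !tX (qbinomial c qcomm_x) (qbinomial d qcomm_X).
rewrite tM -mulrA mulr_suml mulr_sumr; apply: eq_bigr => i _.
rewrite !mulr_sumr; apply: eq_bigr => j _.
rewrite -scalerAr -!scalerAl -!scalerAr !scalerA !tX !tM !expr1n !mulr1.
rewrite -[RHS]scalerA -[X in _ = _ *: X]tZr; congr (_ *: t _ _); rewrite ?mulrA // 1?mulrC //.
have hH : GRing.comm (y gh) (y gH) := qrel_hH yrel.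
rewrite -[_ * y gx ^+ _ * y gH ^+ _]mulrA (qcommX _ _ (qrel_xH yrel)).
rewrite -scalerAr -scalerAl; congr (_ *: _); rewrite !exprD !mulrA.
rewrite -[y gh ^+ a * y gH ^+ b * _]mulrA -[y gh ^+ a * y gh ^+ i * _]mulrA.
by rewrite (commrX i (commr_sym (commrX b hH))).
Qed.

End Comultiplication.

(** * Ordered monomials span the quotient *)

Section Congruence.
Variables (k : fieldType) (R : seq (falg k)).
Implicit Types f g h : falg k.

Definition cong f g := in_ideal R (fsub f g).

Lemma in_ideal_gen r : r \in R -> in_ideal R r.
Proof.
move=> rR; exists [:: (fone k, r, fone k)]; split=> [t|]; first by rewrite inE => /eqP->.
apply: evl_feq => F; rewrite /= cats0 !evl_mul /fone evl_cons evl_nil addr0 scale1r.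
by apply: eq_evl => w; rewrite evl_cons evl_nil addr0 scale1r cats0.
Qed.

Lemma in_ideal_scale c f : in_ideal R f -> in_ideal R (fscale c f).
Proof.
move/(in_idealMl (fmon c [::])); apply: in_ideal_feq; apply: evl_feq => F.
by rewrite evl_mul evl_scale /fmon evl_cons evl_nil addr0.
Qed.

Lemma feq_cong f g : feq f g -> cong f g.
Proof.
move=> efg; exists [::]; split=> //; apply: evl_feq => F.
by rewrite evl_sub (feq_evl F efg) subrr evl_nil.
Qed.

Lemma cong_refl f : cong f f.
Proof. exact: feq_cong. Qed.

Lemma cong_sym f g : cong f g -> cong g f.
Proof.
move/(in_ideal_scale (-1)); apply: in_ideal_feq; apply: evl_feq => F.
by rewrite evl_scale !evl_sub scaleN1r opprB.
Qed.

Lemma cong_trans g f h : cong f g -> cong g h -> cong f h.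
Proof.
move=> fg gh; apply: in_ideal_feq (in_ideal_cat fg gh); apply: evl_feq => F.
by rewrite evl_cat !evl_sub addrA subrK.
Qed.

Lemma cong_cat f f' g g' : cong f f' -> cong g g' -> cong (f ++ g) (f' ++ g').
Proof.
move=> ff gg; apply: in_ideal_feq (in_ideal_cat ff gg); apply: evl_feq => F.
by rewrite !(evl_cat, evl_sub) opprD addrACA.
Qed.

Lemma cong_scale c f g : cong f g -> cong (fscale c f) (fscale c g).
Proof.
move/(in_ideal_scale c); apply: in_ideal_feq; apply: evl_feq => F.
by rewrite !(evl_scale, evl_sub) scalerBr.
Qed.

Lemma cong_mulr f g h : cong f g -> cong (fmul h f) (fmul h g).
Proof.
move/(in_idealMl h); apply: in_ideal_feq; apply: evl_feq => F.
rewrite evl_sub !evl_mul [LHS]/evl [X in _ = X - _]/evl [X in _ = _ - X]/evl -sumrB.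
by apply: eq_bigr => p _ /=; rewrite evl_sub scalerBr.
Qed.

Lemma cong_mull f g h : cong f g -> cong (fmul f h) (fmul g h).
Proof.
move/(in_idealMr h); apply: in_ideal_feq; apply: evl_feq => F.
by rewrite !(evl_sub, evl_mul).
Qed.

Lemma cong_mon z a b u v :
  cong (fmon 1 a) (fmon z b) -> cong (fmon 1 (u ++ a ++ v)) (fmon z (u ++ b ++ v)).
Proof.
move/(cong_mull (fmon 1 v))/(cong_mulr (fmon 1 u)).
by rewrite /fmul /= !mul1r !mulr1.
Qed.

Lemma cong_mon_scale c z a b :
  cong (fmon 1 a) (fmon z b) -> cong (fmon c a) (fmon (c * z) b).
Proof. by move/(cong_scale c); rewrite /fscale /= mulr1. Qed.

Lemma cong_mon_trans c z a b e :
  cong (fmon 1 a) (fmon c b) -> cong (fmon 1 b) (fmon z e) -> cong (fmon 1 a) (fmon (c * z) e).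
Proof. by move=> ab /(cong_mon_scale c); apply: cong_trans. Qed.

Lemma cong_past z i j e u v :
  cong (fmon 1 [:: i; j]) (fmon z [:: j; i]) ->
  cong (fmon 1 (u ++ i :: nseq e j ++ v)) (fmon (z ^+ e) (u ++ nseq e j ++ i :: v)).
Proof.
move=> ij; elim: e u => [|e IHe] u; first by rewrite expr0; apply: cong_refl.
rewrite exprS; apply: cong_mon_trans (cong_mon u (nseq e j ++ v) ij) _.
by have := IHe (rcons u j); rewrite !cat_rcons.
Qed.

End Congruence.

Lemma in_ideal_incl (k : fieldType) (R S : seq (falg k)) f :
  (forall r, r \in R -> in_ideal S r) -> in_ideal R f -> in_ideal S f.
Proof.
move=> RS [l [lR El]]; apply: (@in_ideal_feq _ _ (flatten
  [seq fmul (fmul t.1.1 t.1.2) t.2 | t <- l])) => [w|]; first by rewrite El.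
elim: l lR {El} => [|t l IHl] lR /=; first by exists [::]; split.
apply: in_ideal_cat; last by apply: IHl => t' t'l; apply: lR; rewrite inE t'l orbT.
by apply/in_idealMr/in_idealMl/RS/lR; rewrite mem_head.
Qed.

Local Arguments fscale : simpl never.

Section Spanning.
Variables (k : fieldType) (m n : nat) (q qb sigma lam : k).
Hypotheses (Hm : (1 < m)%N) (Hn : (1 < n)%N) (Hsigma : sigma != 0).

Definition rels_gen : seq (falg k) :=
  [:: fsub (fmon 1 (nseq m gh)) (fone k);
      fsub (fmon 1 (nseq n gH)) (fone k);
      fmon 1 (nseq m gx);
      fmon 1 (nseq n gX);
      fsub (fmon 1 [:: gx; gh]) (fmon q [:: gh; gx]);
      fsub (fmon 1 [:: gX; gH]) (fmon qb [:: gH; gX]);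
      fsub (fmon 1 [:: gx; gH]) (fmon sigma [:: gH; gx]);
      fsub (fmon 1 [:: gh; gX]) (fmon sigma [:: gX; gh]);
      fsub (fsub (fmon 1 [:: gx; gX]) (fmon sigma [:: gX; gx]))
           (fscale lam (fsub (fone k) (fmon 1 [:: gH; gh])));
      fsub (fmon 1 [:: gh; gH]) (fmon 1 [:: gH; gh])].

Lemma rels_genP (A : algType k) (y : gen -> A) :
  qrel m n q qb sigma lam y <-> (forall r, r \in rels_gen -> ev y r = 0).
Proof.
split=> [[hm Hn' xm Xn xh XH xH hX xX hH] r|yR]; last first.
  have yR' i : (i < 10)%N -> ev y (nth [::] rels_gen i) = 0.
    by move=> i10; apply: yR; apply: mem_nth.
  split.
  - by apply/eqP; have := yR' 0 isT; rewrite /= !evE => /eqP; rewrite subr_eq0.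
  - by apply/eqP; have := yR' 1 isT; rewrite /= !evE => /eqP; rewrite subr_eq0.
  - by have := yR' 2 isT; rewrite /= !evE.
  - by have := yR' 3 isT; rewrite /= !evE.
  - by apply/eqP; have := yR' 4 isT; rewrite /= !evE => /eqP; rewrite subr_eq0.
  - by apply/eqP; have := yR' 5 isT; rewrite /= !evE => /eqP; rewrite subr_eq0.
  - by apply/eqP; have := yR' 6 isT; rewrite /= !evE => /eqP; rewrite subr_eq0.
  - by apply/eqP; have := yR' 7 isT; rewrite /= !evE => /eqP; rewrite subr_eq0.
  - by apply/eqP; have := yR' 8 isT; rewrite /= !evE => /eqP; rewrite subr_eq0.
  - by apply/eqP; have := yR' 9 isT; rewrite /= !evE => /eqP; rewrite subr_eq0.
rewrite !inE; do !case/predU1P => [-> | ]; last move/eqP->.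
all: by rewrite !evE ?(hm, Hn', xm, Xn, xh, XH, xH, hX, xX, hH) ?subrr.
Qed.

Let cong := cong rels_gen.

Definition pbword a b c d : word := nseq a gh ++ nseq b gH ++ nseq c gx ++ nseq d gX.

Lemma pbword_inj a b c d a' b' c' d' :
  pbword a b c d = pbword a' b' c' d' -> (a, b, c, d) = (a', b', c', d').
Proof.
move=> eqw; have cnt i : count_mem i (pbword a b c d) = count_mem i (pbword a' b' c' d').
  by rewrite eqw.
have := (cnt gh, cnt gH, cnt gx, cnt gX).
move: (cnt gh) (cnt gH) (cnt gx) (cnt gX); rewrite /pbword !count_cat !count_nseq /=.
by rewrite !(mul0n, mul1n, addn0, add0n) => -> -> -> ->.
Qed.

Lemma wv_pbword (A : algType k) (y : gen -> A) a b c d :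
  wv y (pbword a b c d) = pbw y a b c d.
Proof. by rewrite !wv_cat !wv_nseq /pbw !mulrA. Qed.

Definition reduced (w : word) := exists a b c d,
  [/\ (a < m)%N, (b < n)%N, (c < m)%N, (d < n)%N & w = pbword a b c d].

Definition spanned (f : falg k) :=
  exists2 l : falg k, (forall p, p \in l -> reduced p.2) & cong f l.

Lemma spanned_cong f g : cong f g -> spanned g -> spanned f.
Proof. by move=> fg [l lred gl]; exists l => //; apply: cong_trans gl. Qed.

Lemma spanned_cat f g : spanned f -> spanned g -> spanned (f ++ g).
Proof.
move=> [l lred fl] [l' lred' gl']; exists (l ++ l'); last exact: cong_cat.
by move=> p; rewrite mem_cat => /orP[/lred|/lred'].
Qed.

Lemma spanned_scale c f : spanned f -> spanned (fscale c f).
Proof.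
move=> [l lred fl]; exists (fscale c l); last exact: cong_scale.
by move=> p /mapP[p' /lred p'red ->].
Qed.

Lemma spanned_mon z w : spanned (fmon 1 w) -> spanned (fmon z w).
Proof. by move/(spanned_scale z); rewrite /fscale /= mulr1. Qed.

Lemma spanned_mon_cong z w w' :
  cong (fmon 1 w) (fmon z w') -> spanned (fmon 1 w') -> spanned (fmon 1 w).
Proof. by move=> ww' w's; apply: spanned_cong ww' _; apply: spanned_mon. Qed.

Lemma spanned_nil : spanned [::].
Proof. by exists [::] => //; apply: cong_refl. Qed.

Lemma rels_gen_nth i : (i < 10)%N -> in_ideal rels_gen (nth [::] rels_gen i).
Proof. by move=> i10; apply/in_ideal_gen/mem_nth. Qed.

Lemma cong_expmod e g u v : (0 < e)%N ->
  cong (fmon 1 (nseq e g)) (fone k) ->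
  forall a, cong (fmon 1 (u ++ nseq a g ++ v)) (fmon 1 (u ++ nseq (a %% e) g ++ v)).
Proof.
move=> e0 ge a; rewrite {1}(divn_eq a e); elim: (a %/ e)%N => [|j IHj].
  by rewrite mul0n add0n; apply: cong_refl.
rewrite mulSn -addnA nseqD -catA; apply: cong_trans IHj.
exact: (cong_mon _ _ (b := [::]) ge).
Qed.

Lemma cong_nil e g u v z a : (e <= a)%N -> in_ideal rels_gen (fmon 1 (nseq e g)) ->
  cong (fmon z (u ++ nseq a g ++ v)) [::].
Proof.
move=> ea ge; rewrite -(subnKC ea) nseqD -catA.
have := in_idealMl (fmon z u) (in_idealMr (fmon 1 (nseq (a - e) g ++ v)) ge).
rewrite /fmul /= !mulr1; apply: in_ideal_feq; apply: evl_feq => F.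
by rewrite evl_sub evl_nil subr0.
Qed.

Lemma spanned_pbword a b c d : spanned (fmon 1 (pbword a b c d)).
Proof.
have m0 : (0 < m)%N by exact: ltnW.
have n0 : (0 < n)%N by exact: ltnW.
have [cm|mc] := ltnP c m; last first.
  apply: spanned_cong spanned_nil; rewrite /pbword catA.
  exact: cong_nil mc (rels_gen_nth (i := 2) isT).
have [dn|nd] := ltnP d n; last first.
  apply: spanned_cong spanned_nil; rewrite /pbword -[nseq d gX]cats0 !catA -catA.
  exact: cong_nil nd (rels_gen_nth (i := 3) isT).
exists (fmon 1 (pbword (a %% m) (b %% n) c d)).
  move=> p; rewrite inE => /eqP-> /=; exists (a %% m)%N, (b %% n)%N, c, d.
  by rewrite !ltn_mod m0 n0.
apply: cong_trans (cong_expmod [::] _ m0 (rels_gen_nth (i := 0) isT) a) _.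
exact: cong_expmod _ _ n0 (rels_gen_nth (i := 1) isT) b.
Qed.

(** The span of the ordered words contains 1, so stability under left multiplication by the
    generators makes it everything. By linearity, stability is needed on ordered words only. *)
Lemma spanned_mul i f :
  (forall a b c d, spanned (fmon 1 (i :: pbword a b c d))) ->
  spanned f -> spanned (fmul (fgen k i) f).
Proof.
move=> Si [l lred fl]; apply: spanned_cong (cong_mulr (fgen k i) fl) _.
elim: l lred {fl} => [|p l IHl] lred; first exact: spanned_nil.
have -> : fmul (fgen k i) (p :: l) = fmon (1 * p.1) (i :: p.2) ++ fmul (fgen k i) l by [].
apply: spanned_cat; last by apply: IHl => p' p'l; apply: lred; rewrite inE p'l orbT.
have [|a [b [c [d [_ _ _ _ ->]]]]] := lred p; first exact: mem_head.
exact: spanned_mon.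
Qed.

Lemma spanned_h a b c d : spanned (fmon 1 (gh :: pbword a b c d)).
Proof. exact: (spanned_pbword a.+1). Qed.

Lemma spanned_H a b c d : spanned (fmon 1 (gH :: pbword a b c d)).
Proof.
apply: spanned_mon_cong (spanned_pbword a b.+1 c d).
apply: (cong_past (z := 1) a [::]).
exact: cong_sym (rels_gen_nth (i := 9) isT).
Qed.

Lemma spanned_x a b c d : spanned (fmon 1 (gx :: pbword a b c d)).
Proof.
apply: spanned_mon_cong (spanned_pbword a b c.+1 d).
apply: cong_mon_trans (cong_past a [::] _ (rels_gen_nth (i := 4) isT)) _.
exact: cong_past b (nseq a gh) _ (rels_gen_nth (i := 6) isT).
Qed.

Let cong_Xh : cong (fmon 1 [:: gX; gh]) (fmon sigma^-1 [:: gh; gX]).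
Proof.
have /cong_sym/(cong_scale sigma^-1) := rels_gen_nth (i := 7) isT.
by rewrite /fscale /= mulVf // mulr1.
Qed.

Let cong_Xx u v : cong (fmon 1 (u ++ [:: gX; gx] ++ v))
  (fscale sigma^-1 (fmon 1 (u ++ [:: gx; gX] ++ v) ++
     fscale (- lam) (fmon 1 (u ++ v)) ++ fscale lam (fmon 1 (u ++ [:: gH; gh] ++ v)))).
Proof.
have /(in_idealMr (fmon 1 v))/(in_idealMl (fmon 1 u)) := rels_gen_nth (i := 8) isT.
move/(in_ideal_scale (- sigma^-1)); apply: in_ideal_feq; apply: evl_feq => F.
rewrite /evl /= !big_cons !big_nil /= /GRing.scale /=.
by field.
Qed.

Lemma spanned_X a b c d : spanned (fmon 1 (gX :: pbword a b c d)).
Proof.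
suff {a b} SX a b : spanned (fmon 1 (nseq a gh ++ nseq b gH ++ gX :: nseq c gx ++ nseq d gX)).
  apply: spanned_mon_cong (SX a b).
  apply: cong_mon_trans (cong_past a [::] _ cong_Xh) _.
  exact: cong_past b (nseq a gh) _ (rels_gen_nth (i := 5) isT).
(* [X] is the only generator whose move into place creates lower terms. Exchanging it with one [x]
   leaves a word with one [x] fewer to pass and two words from which both letters have
   disappeared. *)
elim: c a b => [|c IHc] a b; first exact: spanned_pbword a b 0%N d.+1.
have := cong_Xx (nseq a gh ++ nseq b gH) (nseq c gx ++ nseq d gX).
rewrite -!catA => /spanned_cong; apply; apply/spanned_scale/spanned_cat.
  (* The new [x] stands between H^b and [X], so the induction hypothesis is used without group-like
     prefix, and [x], then H^b, then h^a are multiplied back on the left. *)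
  have := IHc 0%N 0%N => /(spanned_mul spanned_x).
  rewrite /fmul /= mulr1 => Sx.
  elim: a => [|a IHa]; last by have := spanned_mul spanned_h IHa; rewrite /fmul /= mulr1.
  by elim: b => [|b IHb] //; have := spanned_mul spanned_H IHb; rewrite /fmul /= mulr1.
apply: spanned_cat; apply: spanned_scale; first exact: spanned_pbword.
have SHh : spanned (fmon 1 (nseq b gH ++ [:: gH, gh & nseq c gx ++ nseq d gX])).
  have S0 := spanned_pbword 1 0 c d.
  have := spanned_mul spanned_H S0; rewrite /fmul /= mulr1 => {}S0.
  by elim: b => [|b IHb] //; have := spanned_mul spanned_H IHb; rewrite /fmul /= mulr1.
by elim: a => [|a IHa] //; have := spanned_mul spanned_h IHa; rewrite /fmul /= mulr1.
Qed.

Lemma spanned_all f : spanned f.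
Proof.
have Sgen i a b c d : spanned (fmon 1 (i :: pbword a b c d)).
  case: i => -[|[|[|[|//]]]] lt_i.
  - rewrite (_ : Ordinal _ = gh); [exact: spanned_h | exact: val_inj].
  - rewrite (_ : Ordinal _ = gx); [exact: spanned_x | exact: val_inj].
  - rewrite (_ : Ordinal _ = gH); [exact: spanned_H | exact: val_inj].
  - rewrite (_ : Ordinal _ = gX); [exact: spanned_X | exact: val_inj].
have Sw w : spanned (fmon 1 w).
  elim: w => [|i w IHw]; first exact: (spanned_pbword 0 0 0 0).
  by have := spanned_mul (Sgen i) IHw; rewrite /fmul /= mulr1.
elim: f => [|[c w] f IHf]; first exact: spanned_nil.
exact: spanned_cat (spanned_mon c (Sw w)) IHf.
Qed.

(* Linear independence of the ordered monomials in one algebra satisfying the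
   relations makes that algebra a faithful image of the quotient. *)
Lemma in_ideal_co (A : algType k) (y : gen -> A) (co : nat -> nat -> nat -> nat -> A -> k) f :
  qrel m n q qb sigma lam y ->
  (forall a b c d, {morph co a b c d : u v / u + v}) ->
  (forall a b c d z u, co a b c d (z *: u) = z * co a b c d u) ->
  (forall a b c d a' b' c' d',
     (c < m)%N -> (d < n)%N -> (c' < m)%N -> (d' < n)%N ->
     co a b c d (pbw y a' b' c' d') =
       [&& a == a' %[mod m], b == b' %[mod n], c == c' & d == d']%N%:R) ->
  (forall a b c d, (a < m)%N -> (b < n)%N -> (c < m)%N -> (d < n)%N ->
     co a b c d (ev y f) = 0) ->
  in_ideal rels_gen f.
Proof.
move=> yrel coD coZ copbw yf; have [l lred fl] := spanned_all f.
have yl : ev y f = ev y l.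
  have := ev_in_ideal (proj1 (rels_genP y) yrel) fl.
  by rewrite ev_sub => /eqP; rewrite subr_eq0 => /eqP.
suff l0 : feq l [::].
  apply: in_ideal_feq fl; apply: evl_feq => F.
  by rewrite evl_sub (feq_evl F l0) evl_nil subr0.
move=> w; rewrite [RHS]/coef big_nil.
have co0 a b c d : co a b c d 0 = 0 by rewrite -(scale0r (0 : A)) coZ mul0r.
have [|wl] := boolP (w \in [seq p.2 | p <- l]); last first.
  rewrite /coef big_seq_cond big1 // => p /andP[pl /eqP pw].
  by rewrite -pw map_f in wl.
case/mapP => p /lred[a [b [c [d [am bn cm dn ->]]]]] ->.
rewrite -(yf a b c d) // yl.
rewrite /ev /evl (big_morph _ (coD a b c d) (co0 a b c d)) /coef big_mkcond.
rewrite big_seq [RHS]big_seq; apply: eq_bigr => r /lred[a' [b' [c' [d' [am' bn' cm' dn' ->]]]]].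
rewrite coZ wv_pbword copbw // !modn_small //.
case: eqP => [/pbword_inj[-> -> -> ->]|ne]; first by rewrite !eqxx mulr1.
case: and4P => [[/eqP ea /eqP eb /eqP ec /eqP ed]|_]; last by rewrite mulr0.
by case: ne; rewrite ea eb ec ed.
Qed.

End Spanning.

(** * The regular representation *)

(** The interface through which the regular representation is used from here on. [mco] is a
    functional dual to an ordered monomial, with the exponents of h and H read modulo m and n;
    [mco2] is a tensor product of two such functionals. *)
Record pbw_model (k : fieldType) (m n : nat) (q qb sigma lam : k) := PbwModel {
  mA : algType k;
  mA2 : algType k;
  mt : mA -> mA -> mA2;
  mtDl : forall v, {morph mt^~ v : u u' / u + u'};
  mtDr : forall u, {morph mt u : v v' / v + v'};
  mtZl : forall c u v, mt (c *: u) v = c *: mt u v;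
  mtZr : forall c u v, mt u (c *: v) = c *: mt u v;
  mtM : forall u v u' v', mt u v * mt u' v' = mt (u * u') (v * v');
  mt11 : mt 1 1 = 1;
  my : gen -> mA;
  mrel : qrel m n q qb sigma lam my;
  mco : nat -> nat -> nat -> nat -> mA -> k;
  mcoD : forall a b c d, {morph mco a b c d : u v / u + v};
  mcoZ : forall a b c d z u, mco a b c d (z *: u) = z * mco a b c d u;
  mco_pbw : forall a b c d a' b' c' d',
    (c < m)%N -> (d < n)%N -> (c' < m)%N -> (d' < n)%N ->
    mco a b c d (pbw my a' b' c' d') =
      [&& a == a' %[mod m], b == b' %[mod n], c == c' & d == d']%N%:R;
  mco2 : nat -> nat -> nat -> nat -> nat -> nat -> nat -> nat -> mA2 -> k;
  mco2D : forall a b c d a' b' c' d', {morph mco2 a b c d a' b' c' d' : u v / u + v};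
  mco2Z : forall a b c d a' b' c' d' z u,
    mco2 a b c d a' b' c' d' (z *: u) = z * mco2 a b c d a' b' c' d' u;
  mco2_t : forall a b c d a' b' c' d' u v,
    mco2 a b c d a' b' c' d' (mt u v) = mco a b c d u * mco a' b' c' d' v }.

Section RegularRepresentation.
Variables (k : fieldType) (m n : nat) (q qb sigma lam : k).
Hypotheses (Hm : (1 < m)%N) (Hn : (1 < n)%N).
Hypotheses (Hq : m.-primitive_root q) (Hqb : n.-primitive_root qb).
Hypotheses (Hsm : sigma ^+ m = 1) (Hsn : sigma ^+ n = 1).
Hypothesis Hlam : lam != 0 -> [/\ m = n, qb = q^-1 & sigma = q].

Let m0 : (0 < m)%N := ltnW Hm.
Let n0 : (0 < n)%N := ltnW Hn.

Let q0 : q != 0.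
Proof.
apply: contraTneq (oner_neq0 k) => q_0.
by rewrite -(prim_expr_order Hq) q_0 expr0n gtn_eqF // eqxx.
Qed.

Let s0 : sigma != 0.
Proof. by apply: contraTneq (oner_neq0 k) => s_0; rewrite -Hsm s_0 expr0n gtn_eqF // eqxx. Qed.

Let B : Type := ('I_m * 'I_n * 'I_m * 'I_n)%type.

Let mk a b c d : B :=
  (Ordinal (ltn_pmod a m0), Ordinal (ltn_pmod b n0),
   Ordinal (ltn_pmod c m0), Ordinal (ltn_pmod d n0)).

(** Square matrices form a unital algebra at sizes of the form [N.+1]. *)
Let N := #|{: B}|.-1.

Let cardB : #|{: B}| = N.+1.
Proof. by rewrite prednK //; apply/card_gt0P; exists (mk 0 0 0 0). Qed.

Let idx (b : B) : 'I_N.+1 := cast_ord cardB (enum_rank b).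
Let idxV (i : 'I_N.+1) : B := enum_val (cast_ord (esym cardB) i).

Let idxK : cancel idx idxV.
Proof. by move=> b; rewrite /idxV /idx cast_ordK enum_rankK. Qed.

Let idxVK : cancel idxV idx.
Proof. by move=> i; rewrite /idxV /idx enum_valK cast_ordKV. Qed.

(* The ordered monomial h^a H^b x^c X^d as a vector; [a], [b] matter modulo
   [m], [n], and the vector vanishes once [m <= c] or [n <= d]. *)
Let e a b c d : 'cV[k]_N.+1 :=
  if (c < m)%N && (d < n)%N then delta_mx (idx (mk a b c d)) 0 else 0.

Let eE a b c d a' b' : a = a' %[mod m] -> b = b' %[mod n] -> e a b c d = e a' b' c d.
Proof.
move=> ea eb; rewrite /e; case: ifP => // _; congr (delta_mx (idx (_, _, _, _)) _).
  exact: val_inj.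
exact: val_inj.
Qed.

Let e_big a b c d : (m <= c)%N || (n <= d)%N -> e a b c d = 0.
Proof. by rewrite (leqNgt m c) (leqNgt n d) -negb_and /e => /negPf->. Qed.

Let colmx (F : nat -> nat -> nat -> nat -> 'cV[k]_N.+1) : 'M[k]_N.+1 :=
  \matrix_(i, j) (let: (a, b, c, d) := idxV j in F a b c d) i 0.

(** Periodicity in [a], [b] and vanishing for large [c], [d] extend the column formula to all
    natural exponents, so the relations can be checked without treating wrap-around and overflow
    apart. *)
Let colmxE F a b c d :
  (forall a b c d, F (a %% m)%N (b %% n)%N c d = F a b c d) ->
  (forall a b c d, (m <= c)%N || (n <= d)%N -> F a b c d = 0) ->
  colmx F *m e a b c d = F a b c d.
Proof.
move=> Fper F0; have [cd|/negPf cd] := boolP ((c < m)%N && (d < n)%N); last first.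
  rewrite /e cd mulmx0 F0 //; by rewrite (leqNgt m c) (leqNgt n d) -negb_and cd.
rewrite /e cd -colE; apply/matrixP => i j; rewrite !mxE ord1 idxK /= Fper.
by case/andP: cd => cm dn; rewrite !modn_small.
Qed.

Let eq_on_e (u v : 'M[k]_N.+1) :
  (forall a b c d, u *m e a b c d = v *m e a b c d) -> u = v.
Proof.
move=> uv; apply/matrixP => i j; have := uv (idxV j).1.1.1 (idxV j).1.1.2 (idxV j).1.2 (idxV j).2.
rewrite /e !ltn_ord /= (_ : mk _ _ _ _ = idxV j).
  by rewrite idxVK -!colE => /matrixP/(_ i 0); rewrite !mxE.
case: (idxV j) => [[[a b] c] d] /=; congr (_, _, _, _); apply: val_inj => /=; exact: modn_small.
Qed.

(* Coefficients in
   X x^c = s^c x^c X - lam (alpha c - beta c H h) x^(c-1), with s = sigma^-1. *)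
Let s := sigma^-1.
Let alpha c := q^-1 * qnat q^-1 c.
Let beta c := q^-1 * qnat q c.

Let alpha0 : alpha 0 = 0. Proof. by rewrite /alpha /qnat big_ord0 mulr0. Qed.
Let beta0 : beta 0 = 0. Proof. by rewrite /beta /qnat big_ord0 mulr0. Qed.

(** The recursions come from X x^(c+1) = s (xX - lam (1 - Hh)) x^c with sigma = q. The extra q^2 in
    [betaS] is the cost of moving [x] past [H * h]. *)
Let alphaS c : q * alpha c.+1 = 1 + alpha c.
Proof. by rewrite /alpha qnatS; field. Qed.

Let betaS c : q * beta c.+1 = 1 + q * (q * beta c).
Proof. by rewrite /beta qnatS; field. Qed.

(** At [c = m] the lower term of [FX] still carries x^(m-1). The vanishing of [alpha m] and [beta m]
    removes it, so that [X] sends the zero vector [e a b m d] to zero. *)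
Let alpha_m : alpha m = 0.
Proof.
suff: qnat q^-1 m = 0 by rewrite /alpha => ->; rewrite mulr0.
have := qnat_geom q^-1 m; rewrite exprVn prim_expr_order // invr1 subrr => /eqP.
rewrite mulf_eq0 subr_eq0 eq_sym invr_eq1 (negPf (prim_neq1 Hm Hq)) => /eqP //.
Qed.

Let beta_m : beta m = 0.
Proof. by rewrite /beta (qnat_prim Hm Hq) mulr0. Qed.

Let Fh a b c d := e a.+1 b c d.
Let FH a b c d := e a b.+1 c d.
Let Fx a b c d := (q ^+ a * sigma ^+ b) *: e a b c.+1 d.
(** At [c = 0] the truncated [c.-1] is harmless because [alpha 0] and [beta 0] vanish. *)
Let FX a b c d := (s ^+ (a + c) * qb ^+ b) *: e a b c d.+1
  - (lam * (s ^+ a * qb ^+ b)) *: (alpha c *: e a b c.-1 d - beta c *: e a.+1 b.+1 c.-1 d).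

Let yreg (i : gen) : 'M[k]_N.+1 :=
  match val i with
  | 0%N => colmx Fh
  | 1%N => colmx Fx
  | 2%N => colmx FH
  | _ => colmx FX
  end.

Let expmod (z : k) j a : z ^+ j = 1 -> z ^+ (a %% j) = z ^+ a.
Proof. by move=> zj; rewrite {2}(divn_eq a j) exprD mulnC exprM zj expr1n mul1r. Qed.

Let he a b c d : yreg gh *m e a b c d = e a.+1 b c d.
Proof.
apply: colmxE => [a' b' c' d'|a' b' c' d'] //; last exact: e_big.
by apply: eE; rewrite ?modn_mod // -addn1 modnDml addn1.
Qed.

Let He a b c d : yreg gH *m e a b c d = e a b.+1 c d.
Proof.
apply: colmxE => [a' b' c' d'|a' b' c' d'] //; last exact: e_big.
by apply: eE; rewrite ?modn_mod // -addn1 modnDml addn1.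
Qed.

Let xe a b c d : yreg gx *m e a b c d = (q ^+ a * sigma ^+ b) *: e a b c.+1 d.
Proof.
apply: colmxE => [a' b' c' d'|a' b' c' d' big].
  rewrite /Fx (expmod _ (prim_expr_order Hq)) (expmod _ Hsn).
  by congr (_ *: _); apply: eE; rewrite modn_mod.
rewrite /Fx e_big ?scaler0 //; case/orP: big => [/leqW->|->] //; exact: orbT.
Qed.

Let Xe a b c d : yreg gX *m e a b c d = FX a b c d.
Proof.
have sm : s ^+ m = 1 by rewrite exprVn Hsm invr1.
apply: colmxE => [a' b' c' d'|a' b' c' d' big].
  rewrite /FX !exprD !(expmod _ sm) !(expmod _ (prim_expr_order Hqb)).
  congr (_ *: _ - _ *: (_ *: _ - _ *: _)); apply: eE; rewrite ?modn_mod //.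
  - by rewrite -addn1 modnDml addn1.
  - by rewrite -addn1 modnDml addn1.
rewrite /FX e_big ?scaler0 ?sub0r; last by case/orP: big => [->|/leqW->] //; rewrite orbT.
have [d_n|d_n] := boolP (n <= d')%N.
  by rewrite !e_big ?d_n ?orbT // !scaler0 subr0 scaler0 oppr0.
rewrite (negPf d_n) orbF in big.
case: (ltngtP c' m) big => // [m_c | ->] _; last first.
  by rewrite alpha_m beta_m !scale0r subr0 scaler0 oppr0.
have mc : (m <= c'.-1)%N by rewrite -ltnS prednK // (leq_ltn_trans _ m_c).
by rewrite !e_big ?mc // !scaler0 subr0 scaler0 oppr0.
Qed.

Let mulmxE (u v : 'M[k]_N.+1) : u * v = u *m v. Proof. by []. Qed.

Let hXe j a b c d : yreg gh ^+ j *m e a b c d = e (a + j) b c d.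
Proof.
elim: j => [|j IHj]; first by rewrite expr0 mul1mx addn0.
by rewrite exprS mulmxE -mulmxA IHj he addnS.
Qed.

Let HXe j a b c d : yreg gH ^+ j *m e a b c d = e a (b + j) c d.
Proof.
elim: j => [|j IHj]; first by rewrite expr0 mul1mx addn0.
by rewrite exprS mulmxE -mulmxA IHj He addnS.
Qed.

Let xXe j a b c d :
  yreg gx ^+ j *m e a b c d = (q ^+ a * sigma ^+ b) ^+ j *: e a b (c + j) d.
Proof.
elim: j => [|j IHj]; first by rewrite expr0 mul1mx addn0 scale1r.
by rewrite exprS mulmxE -mulmxA IHj -scalemxAr xe scalerA -exprSr addnS.
Qed.

Let XXe j d : yreg gX ^+ j *m e 0 0 0 d = e 0 0 0 (d + j).
Proof.
elim: j => [|j IHj]; first by rewrite expr0 mul1mx addn0.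
rewrite exprS mulmxE -mulmxA IHj Xe /FX alpha0 beta0 !scale0r subr0 scaler0 subr0.
by rewrite !expr0 mulr1 scale1r addnS.
Qed.

Let xh : yreg gx * yreg gh = q *: (yreg gh * yreg gx).
Proof.
apply: eq_on_e => a b c d; rewrite -scalemxAl !mulmxE -!mulmxA he !xe -scalemxAr he scalerA.
by rewrite exprS mulrA.
Qed.

Let xH : yreg gx * yreg gH = sigma *: (yreg gH * yreg gx).
Proof.
apply: eq_on_e => a b c d; rewrite -scalemxAl !mulmxE -!mulmxA He !xe -scalemxAr He scalerA.
by rewrite exprS mulrCA.
Qed.

Let XH : yreg gX * yreg gH = qb *: (yreg gH * yreg gX).
Proof.
apply: eq_on_e => a b c d; rewrite -scalemxAl !mulmxE -!mulmxA He !Xe /FX.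
rewrite mulmxBr -!scalemxAr mulmxBr -!scalemxAr !He [RHS]scalerBr !scalerA exprS.
by congr (_ *: _ - _ *: _); ring.
Qed.

Let hX : yreg gh * yreg gX = sigma *: (yreg gX * yreg gh).
Proof.
apply: eq_on_e => a b c d; rewrite -scalemxAl !mulmxE -!mulmxA he !Xe /FX.
rewrite mulmxBr -!scalemxAr mulmxBr -!scalemxAr !he [RHS]scalerBr !scalerA addSn.
rewrite [s ^+ _.+1]exprS [s ^+ a.+1]exprS.
have ss : sigma * s = 1 by rewrite mulfV.
by congr (_ *: _ - _ *: _); rewrite -[LHS]mul1r -ss; ring.
Qed.

Let hH : yreg gh * yreg gH = yreg gH * yreg gh.
Proof. by apply: eq_on_e => a b c d; rewrite !mulmxE -!mulmxA he !He he. Qed.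

Let xX : yreg gx * yreg gX - sigma *: (yreg gX * yreg gx) = lam *: (1 - yreg gH * yreg gh).
Proof.
apply: eq_on_e => a b c d.
rewrite mulmxBl -!scalemxAl mulmxBl !mulmxE -!mulmxA he He xe -scalemxAr !Xe mul1mx.
rewrite /FX mulmxBr -!scalemxAr mulmxBr -!scalemxAr !xe.
have [->|lam0] := eqVneq lam 0.
  rewrite !(mul0r, scale0r, subr0) !scalerA addnS exprS.
  have ss : sigma * s = 1 by rewrite mulfV.
  rewrite -scalerBl; apply/eqP; rewrite scaler_eq0 subr_eq0; apply/orP; left; apply/eqP.
  transitivity (sigma * s * (q ^+ a * sigma ^+ b * (s ^+ (a + c) * qb ^+ b))); last by ring.
  by rewrite ss; ring.
have [_ Eqb Es] := Hlam lam0.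
(* [c.-1.+1] differs from [c] only at [c = 0], where the coefficient is zero. *)
have Ea z u v : alpha c *: (z *: e u v c.-1.+1 d) = (alpha c * z) *: e u v c d.
  by case: (c) => [|c'] /=; rewrite ?alpha0 ?mul0r ?scale0r // scalerA.
have Eb z u v : beta c *: (z *: e u v c.-1.+1 d) = (beta c * z) *: e u v c d.
  by case: (c) => [|c'] /=; rewrite ?beta0 ?mul0r ?scale0r // scalerA.
rewrite Ea Eb /=.
have -> : alpha c.+1 = q^-1 * (1 + alpha c) by rewrite -alphaS mulKf.
have -> : beta c.+1 = q^-1 * (1 + q * (q * beta c)) by rewrite -betaS mulKf.
move: (alpha c) (beta c) => al be; rewrite /s Es Eqb !exprD !exprVn !exprS.
apply/matrixP => i j; rewrite !mxE.
have qa0 : q ^+ a != 0 by rewrite expf_neq0.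
have qb0 : q ^+ b != 0 by rewrite expf_neq0.
have qc0 : q ^+ c != 0 by rewrite expf_neq0.
move: (q ^+ a) (q ^+ b) (q ^+ c) qa0 qb0 qc0 => qa qb' qc qa0 qb0 qc0.
by field; rewrite q0 qa0 qb0 qc0.
Qed.

(** The analogue of the sl_2 commutator formula. At [j.+1 = n] its q-integer vanishes, which makes
    X^n commute with [x]. *)
Let x_Xexp j : lam != 0 ->
  yreg gx * yreg gX ^+ j.+1 = sigma ^+ j.+1 *: (yreg gX ^+ j.+1 * yreg gx)
    + (lam * qnat q j.+1) *: (yreg gX ^+ j * (1 - q ^+ j *: (yreg gH * yreg gh))).
Proof.
move=> lam0; have [_ Eqb Es] := Hlam lam0.
have xX' : yreg gx * yreg gX = sigma *: (yreg gX * yreg gx) + lam *: (1 - yreg gH * yreg gh).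
  by rewrite -xX addrC subrK.
have HhX : yreg gH * yreg gh * yreg gX = (q * q) *: (yreg gX * (yreg gH * yreg gh)).
  rewrite -mulrA hX -scalerAr [yreg gH * (_ * _)]mulrA.
  rewrite (_ : yreg gH * yreg gX = q *: (yreg gX * yreg gH)).
    by rewrite -scalerAl scalerA Es -mulrA.
  by rewrite XH Eqb scalerA mulfV // scale1r.
elim: j => [|j IHj].
  by rewrite !expr1 !expr0 mul1r scale1r qnatS /qnat big_ord0 mulr0 addr0 mulr1.
rewrite exprSr mulrA IHj mulrDl -!scalerAl -[_ * yreg gx * _]mulrA xX' mulrDr scalerDr.
rewrite -!scalerAr scalerA -exprSr !mulrA -exprSr -addrA.
congr (_ + _); first by rewrite -exprSr.
rewrite -[_ * (1 - _ *: _) * _]mulrA mulrBl mul1r -scalerAl HhX !mulrBr !mulr1.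
rewrite -!scalerAr !scalerA !mulrA -exprSr !scalerBr !scalerA.
rewrite [LHS]addrACA -opprD -!scalerDl Es; congr (_ *: _ - _ *: _).
  by rewrite /qnat [in RHS]big_ord_recr /=; ring.
by rewrite [qnat q j.+2]qnatS !exprS; ring.
Qed.

Let xXn : yreg gx * yreg gX ^+ n = yreg gX ^+ n * yreg gx.
Proof.
have [lam0|lam0] := eqVneq lam 0.
  move: xX; rewrite lam0 scale0r => /eqP; rewrite subr_eq0 => /eqP xX0.
  by have := qcommX 1 n xX0; rewrite !expr1 mul1n Hsn scale1r.
have [emn _ _] := Hlam lam0.
have := x_Xexp n.-1 lam0; rewrite prednK // Hsn scale1r (_ : qnat q n = 0).
  by rewrite mulr0 scale0r addr0.
by rewrite -emn; apply: qnat_prim.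
Qed.

Let e_gen a b c d :
  e a b c d = yreg gh ^+ a *m (yreg gH ^+ b *m (yreg gx ^+ c *m e 0 0 0 d)).
Proof. by rewrite xXe !expr0 mulr1 expr1n scale1r HXe hXe !add0n. Qed.

(** X^n passes h^a, H^b and x^c up to scalars and reaches the vector of X^d, on which [X] acts as a
    pure shift. This avoids iterating the two-term formula [FX]. *)
Let Xn : yreg gX ^+ n = 0.
Proof.
have Xh : yreg gX * yreg gh = s *: (yreg gh * yreg gX).
  by rewrite hX scalerA mulVf // scale1r.
apply: eq_on_e => a b c d; rewrite mul0mx e_gen !mulmxA -!mulmxE.
rewrite (qcommX n a Xh) -!scalerAl -[_ * yreg gX ^+ n * _]mulrA (qcommX n b XH).
rewrite -scalerAr -!scalerAl mulrA -[_ * yreg gX ^+ n * _]mulrA.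
have -> : yreg gX ^+ n * yreg gx ^+ c = yreg gx ^+ c * yreg gX ^+ n.
  exact/commrX/commr_sym/xXn.
rewrite !mulmxE -!scalemxAl -!mulmxA XXe (e_big _ _ (d := d + n)) ?mulmx0 ?scaler0 //.
by rewrite leq_addl orbT.
Qed.

Let yreg_qrel : qrel m n q qb sigma lam yreg.
Proof.
split=> //.
- by apply: eq_on_e => a b c d; rewrite hXe mul1mx; apply: eE; rewrite // modnDr.
- by apply: eq_on_e => a b c d; rewrite HXe mul1mx; apply: eE; rewrite // modnDr.
- apply: eq_on_e => a b c d; rewrite xXe mul0mx e_big ?scaler0 //.
  by rewrite leq_addl.
Qed.

Let i0 := idx (mk 0 0 0 0).
(** A coordinate of [u] applied to the vector of the monomial 1; ordered monomials carry that vector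
    to the basis vectors. *)
Let co a b c d (u : 'M[k]_N.+1) : k := u (idx (mk a b c d)) i0.

Let co_pbw a b c d a' b' c' d' :
  (c < m)%N -> (d < n)%N -> (c' < m)%N -> (d' < n)%N ->
  co a b c d (pbw yreg a' b' c' d') =
    [&& a == a' %[mod m], b == b' %[mod n], c == c' & d == d']%N%:R.
Proof.
move=> cm dn cm' dn'.
transitivity ((pbw yreg a' b' c' d' *m e 0 0 0 0) (idx (mk a b c d)) 0).
  by rewrite /e m0 n0 /= -colE mxE.
rewrite /pbw !mulmxE -!mulmxA XXe add0n -e_gen /e cm' dn' /= mxE eqxx andbT.
rewrite (can_eq idxK) /mk !xpair_eqE -!val_eqE /= !(modn_small cm, modn_small dn).
by rewrite !(modn_small cm', modn_small dn') -!andbA.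
Qed.

(** The size is convertible to [N.+1 * N.+1], the size of a Kronecker product, and is visibly a
    successor. *)
Let A2 : algType k := 'M[k]_((N + N * N.+1).+1).
Let t (u v : 'M[k]_N.+1) : A2 := tensmx u v.
Let co2 a b c d a' b' c' d' (w : A2) : k :=
  (w : 'M[k]_(N.+1 * N.+1))
    (mxtens_index (idx (mk a b c d), idx (mk a' b' c' d'))) (mxtens_index (i0, i0)).

Let t11 : t 1 1 = 1.
Proof.
have tens1 : tensmx 1 1 = 1%:M :> 'M[k]_(N.+1 * N.+1).
  apply/matrixP => i j; case: (mxtens_indexP i) => i1 i2; case: (mxtens_indexP j) => j1 j2.
  rewrite tensmxE !mxE (can_eq (@mxtens_indexK _ _)) xpair_eqE.
  by rewrite -natrM mulnb.
exact: tens1.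
Qed.

Lemma regular_model : inhabited (pbw_model m n q qb sigma lam).
Proof.
constructor.
apply: (@PbwModel _ _ _ _ _ _ _ 'M[k]_N.+1 A2 t _ _ _ _ _ _ yreg _ co _ _ _ co2).
- by move=> v u u'; apply/matrixP => i j; rewrite !mxE mulrDl.
- by move=> u v v'; apply/matrixP => i j; rewrite !mxE mulrDr.
- by move=> c u v; apply/matrixP => i j; rewrite !mxE mulrA.
- by move=> c u v; apply/matrixP => i j; rewrite !mxE mulrCA.
- by move=> u v u' v'; exact: (@tensmx_mul k N.+1 N.+1 N.+1 N.+1 N.+1 N.+1 u v u' v').
- exact: t11.
- exact: yreg_qrel.
- by move=> a b c d u v; rewrite /co mxE.
- by move=> a b c d z u; rewrite /co mxE.
- exact: co_pbw.
- by move=> a b c d a' b' c' d' u v; rewrite /co2 mxE.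
- by move=> a b c d a' b' c' d' z u; rewrite /co2 mxE.
- by move=> a b c d a' b' c' d' u v; rewrite /co2 /t tensmxE.
Qed.

End RegularRepresentation.

(** * Group-like and skew-primitive elements *)

Section Model.
Variables (k : fieldType) (m n : nat) (q qb sigma lam : k).
Hypotheses (Hm : (1 < m)%N) (Hn : (1 < n)%N).
Hypotheses (Hq : m.-primitive_root q) (Hqb : n.-primitive_root qb).
Hypothesis Hsm : sigma ^+ m = 1.
Variable M : pbw_model m n q qb sigma lam.

Let y := my M.
Let t := @mt _ _ _ _ _ _ _ M.
Let co := @mco _ _ _ _ _ _ _ M.
Let co2 := @mco2 _ _ _ _ _ _ _ M.
Let dy i := evt t y (dgen_std k i).
Let m0 : (0 < m)%N := ltnW Hm.
Let n0 : (0 < n)%N := ltnW Hn.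

Lemma sigma_neq0 : sigma != 0.
Proof. by apply: contraTneq (oner_neq0 k) => s_0; rewrite -Hsm s_0 expr0n gtn_eqF // eqxx. Qed.

Let dyrel : qrel m n q qb sigma lam dy.
Proof.
apply: (qrel_delta Hm Hn Hq Hqb (t := t)).
- exact: mtDl.
- exact: mtDr.
- exact: mtZl.
- exact: mtZr.
- exact: mtM.
- exact: mt11.
- exact: mrel.
Qed.

Let coD a b c d u v : co a b c d (u + v) = co a b c d u + co a b c d v.
Proof. exact: mcoD. Qed.

Let coZ a b c d z u : co a b c d (z *: u) = z * co a b c d u.
Proof. exact: mcoZ. Qed.

Let co_pbw a b c d a' b' c' d' :
  (c < m)%N -> (d < n)%N -> (c' < m)%N -> (d' < n)%N ->
  co a b c d (pbw y a' b' c' d') =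
    [&& a == a' %[mod m], b == b' %[mod n], c == c' & d == d']%N%:R.
Proof. exact: mco_pbw. Qed.

Let co2D a b c d a' b' c' d' u v :
  co2 a b c d a' b' c' d' (u + v) = co2 a b c d a' b' c' d' u + co2 a b c d a' b' c' d' v.
Proof. exact: mco2D. Qed.

Let co2Z a b c d a' b' c' d' z u :
  co2 a b c d a' b' c' d' (z *: u) = z * co2 a b c d a' b' c' d' u.
Proof. exact: mco2Z. Qed.

Let co2_t a b c d a' b' c' d' u v :
  co2 a b c d a' b' c' d' (t u v) = co a b c d u * co a' b' c' d' v.
Proof. exact: mco2_t. Qed.

Let co0 a b c d : co a b c d 0 = 0.
Proof. by rewrite -(scale0r (0 : mA M)) coZ mul0r. Qed.

Let co20 a b c d a' b' c' d' : co2 a b c d a' b' c' d' 0 = 0.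
Proof. by rewrite -(scale0r (0 : mA2 M)) co2Z mul0r. Qed.

Let co2_sum a b c d a' b' c' d' j (F : 'I_j -> mA2 M) :
  co2 a b c d a' b' c' d' (\sum_(i < j) F i) = \sum_(i < j) co2 a b c d a' b' c' d' (F i).
Proof. exact: (big_morph _ (co2D _ _ _ _ _ _ _ _) (co20 _ _ _ _ _ _ _ _)). Qed.

Let coB a b c d u v : co a b c d (u - v) = co a b c d u - co a b c d v.
Proof. by rewrite coD -scaleN1r coZ mulN1r. Qed.

Lemma in_ideal_model f : in_ideal (rels_gen m n q qb sigma lam) f <-> ev y f = 0.
Proof.
split; first by apply: ev_in_ideal; apply/rels_genP; exact: mrel.
move=> yf; apply: (in_ideal_co Hm Hn sigma_neq0 (mrel M) coD coZ co_pbw) => a b c d _ _ _ _.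
by rewrite yf co0.
Qed.

(** The functionals [co] are only known to separate values of [ev y]; this is why elements are
    handled as such values and not as arbitrary elements of [mA M]. *)
Lemma ev_co_eq f g :
  (forall a b c d, (a < m)%N -> (b < n)%N -> (c < m)%N -> (d < n)%N ->
     co a b c d (ev y f) = co a b c d (ev y g)) -> ev y f = ev y g.
Proof.
move=> eco; apply/eqP; rewrite -subr_eq0 -ev_sub; apply/eqP/in_ideal_model.
apply: (in_ideal_co Hm Hn sigma_neq0 (mrel M) coD coZ co_pbw) => a b c d am bn cm dn.
by rewrite ev_sub coB eco // subrr.
Qed.

(** The structure constant with which degrees (c1, d1) and (c2, d2) occur in the comultiplication of
    x^(c1+c2) X^(d1+d2). Its q-binomials stay below the orders of [q] and [qb], hence are
    nonzero. *)
Let kap c1 d1 c2 d2 :=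
  qbin q (c1 + c2) c1 * qbin qb (d1 + d2) d1 * sigma ^+ (c2 * d1).

Let kap_neq0 c1 d1 c2 d2 : (c1 + c2 < m)%N -> (d1 + d2 < n)%N -> kap c1 d1 c2 d2 != 0.
Proof.
move=> cm dn; rewrite !mulf_neq0 ?expf_neq0 ?sigma_neq0 //.
  by rewrite (qbin_neq0 Hq) ?leq_addr.
by rewrite (qbin_neq0 Hqb) ?leq_addr.
Qed.

Lemma co2_pbw_delta a b c d a1 b1 c1 d1 a2 b2 c2 d2 :
  (c < m)%N -> (d < n)%N ->
  (c1 < m)%N -> (d1 < n)%N -> (c2 < m)%N -> (d2 < n)%N ->
  co2 a1 b1 c1 d1 a2 b2 c2 d2 (pbw dy a b c d) =
  if [&& a2 == a1 + c1 %[mod m], b2 == b1 + d1 %[mod n], c1 + c2 < m & d1 + d2 < n]%N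
  then kap c1 d1 c2 d2 * co a1 b1 (c1 + c2) (d1 + d2) (pbw y a b c d) else 0.
Proof.
move=> cm dn cm1 dn1 cm2 dn2.
rewrite (pbw_delta (@mtZr _ _ _ _ _ _ _ M) (@mtM _ _ _ _ _ _ _ M) (mt11 M) (mrel M)) -/t -/y.
rewrite co2_sum.
have co2E i j : (i <= c)%N -> (j <= d)%N ->
  co2 a1 b1 c1 d1 a2 b2 c2 d2 ((qbin q c i * qbin qb d j * sigma ^+ ((c - i) * j)) *:
      t (pbw y a b i j) (pbw y (a + i) (b + j) (c - i) (d - j))) =
  qbin q c i * qbin qb d j * sigma ^+ ((c - i) * j) *
    ([&& a1 == a %[mod m], b1 == b %[mod n], c1 == i & d1 == j] &&
     [&& a2 == a + i %[mod m], b2 == b + j %[mod n], c2 == c - i & d2 == d - j])%N%:R.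
  move=> ic jd; have im := leq_ltn_trans ic cm; have jn := leq_ltn_trans jd dn.
  have cim := leq_ltn_trans (leq_subr i c) cm.
  have djn := leq_ltn_trans (leq_subr j d) dn.
  by rewrite co2Z co2_t !co_pbw // -natrM mulnb.
(* Only the summand [i = c1], [j = d1] can contribute, and only if the degrees add up to (c, d). *)
have [/andP[/eqP Ec /eqP Ed]|ncd] := boolP ((c == c1 + c2) && (d == d1 + d2))%N; last first.
  rewrite big1 => [|i _]; last first.
    rewrite co2_sum.
    rewrite big1 // => j _; rewrite co2E -1?ltnS //.
    case: andP => [[/and4P[_ _ /eqP Ei /eqP Ej] /and4P[_ _ /eqP Ei' /eqP Ej']]|].
      2: by rewrite mulr0.
    case/negP: ncd; rewrite Ei Ej Ei' Ej' !subnKC -1?ltnS //.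
    by rewrite !eqxx.
  case: and4P => // -[_ _ cm' dn']; rewrite co_pbw // !(eq_sym (_ + _)%N).
  by rewrite (negPf ncd) !andbF mulr0.
have c1c : (c1 < c.+1)%N by rewrite ltnS Ec leq_addr.
have d1d : (d1 < d.+1)%N by rewrite ltnS Ed leq_addr.
rewrite (bigD1 (Ordinal c1c)) //= [X in _ + X]big1 ?addr0 => [|i ne_i]; last first.
  rewrite co2_sum.
  rewrite big1 // => j _; rewrite co2E -1?ltnS //.
  by rewrite -val_eqE /= eq_sym in ne_i; rewrite (negPf ne_i) !andbF mulr0.
rewrite co2_sum.
rewrite (bigD1 (Ordinal d1d)) //= [X in _ + X]big1 ?addr0 => [|j ne_j]; last first.
  rewrite co2E -1?ltnS //.
  by rewrite -val_eqE /= eq_sym in ne_j; rewrite (negPf ne_j) !andbF mulr0.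
rewrite (co2E _ _ (ltnSE c1c) (ltnSE d1d)) co_pbw -?Ec -?Ed //.
rewrite cm dn !eqxx !andbT Ec Ed !addKn !eqxx !andbT /kap.
have [Ea|] := eqVneq (a1 %% m)%N (a %% m)%N; last by rewrite /= !mulr0 if_same.
have [Eb|] := eqVneq (b1 %% n)%N (b %% n)%N; last by rewrite /= !mulr0 if_same.
rewrite /= -(modnDml a1) Ea modnDml -(modnDml b1) Eb modnDml.
by case: ifP => _; rewrite ?mulr1 ?mulr0.
Qed.

(** The dual form of [pbw_delta]: the convolution product of two dual functionals is [kap] times one
    dual functional, or zero. Any equation on a comultiplication thus becomes scalar equations
    between coordinates. *)
Lemma co2_delta f a1 b1 c1 d1 a2 b2 c2 d2 :
  (c1 < m)%N -> (d1 < n)%N -> (c2 < m)%N -> (d2 < n)%N ->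
  co2 a1 b1 c1 d1 a2 b2 c2 d2 (ev dy f) =
  if [&& a2 == a1 + c1 %[mod m], b2 == b1 + d1 %[mod n], c1 + c2 < m & d1 + d2 < n]%N
  then kap c1 d1 c2 d2 * co a1 b1 (c1 + c2) (d1 + d2) (ev y f) else 0.
Proof.
move=> cm1 dn1 cm2 dn2.
have [l lred fl] := spanned_all q qb lam Hm Hn sigma_neq0 f.
have evfl (A' : algType k) (z : gen -> A') : qrel m n q qb sigma lam z -> ev z f = ev z l.
  move=> zrel; have := ev_in_ideal (proj1 (rels_genP m n q qb sigma lam z) zrel) fl.
  by rewrite ev_sub => /eqP; rewrite subr_eq0 => /eqP.
rewrite (evfl _ _ dyrel) (evfl _ _ (mrel M)) {evfl fl f}.
elim: l lred => [|p l IHl] lred; first by rewrite /ev !evl_nil co20 co0 mulr0 if_same.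
rewrite /ev !evl_cons -!/(ev _ _) co2D coD IHl; last first.
  by move=> r rl; apply: lred; rewrite inE rl orbT.
rewrite co2Z coZ.
have [|a [b [c [d [_ _ cm dn ->]]]]] := lred p; first exact: mem_head.
rewrite !wv_pbword co2_pbw_delta // -/y.
by case: ifP => _; [ring | rewrite mulr0 addr0].
Qed.

Lemma group_like_pbw f : ev dy f = t (ev y f) (ev y f) -> ev y f != 0 ->
  exists a b, [/\ (a < m)%N, (b < n)%N & ev y f = pbw y a b 0 0].
Proof.
move=> gl nz; pose cf a b c d := co a b c d (ev y f).
have key a1 b1 c1 d1 a2 b2 c2 d2 :
    (c1 < m)%N -> (d1 < n)%N -> (c2 < m)%N -> (d2 < n)%N ->
    cf a1 b1 c1 d1 * cf a2 b2 c2 d2 =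
    if [&& a2 == a1 + c1 %[mod m], b2 == b1 + d1 %[mod n], c1 + c2 < m & d1 + d2 < n]%N
    then kap c1 d1 c2 d2 * cf a1 b1 (c1 + c2)%N (d1 + d2)%N else 0.
  by move=> *; rewrite /cf -co2_delta // gl co2_t.
(* Descending induction on [c + d] with [N] as fuel: the square of a coordinate of positive degree
   is zero or a multiple of a coordinate of twice that degree. *)
have deg0 N c d : (m + n <= N + (c + d))%N -> (c < m)%N -> (d < n)%N -> (0 < c + d)%N ->
    forall a b, cf a b c d = 0.
  elim: N c d => [|N IHN] c d ge_cd cm dn cd0 a b.
    by move: ge_cd; rewrite add0n leqNgt -addnS leq_add // ltnW.
  suff: cf a b c d * cf a b c d = 0 by move/eqP; rewrite mulf_eq0 orbb => /eqP.
  rewrite key //; case: ifP => // /and4P[_ _ cm' dn'].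
  by rewrite IHN ?mulr0 //; lia.
have cf0 a b : cf a b 0%N 0%N * cf a b 0%N 0%N = cf a b 0%N 0%N.
  by rewrite key // !addn0 !eqxx m0 n0 /= /kap /= mul0n expr0 !mulr1 mul1r.
(* Degree-zero coordinates are idempotent, so a nonzero one equals 1 and, by [key], annihilates the
   others. If all vanish, so does the element. *)
have [[a b] /= ab|none] := pickP (fun ab : 'I_m * 'I_n => cf ab.1 ab.2 0%N 0%N != 0).
  exists a, b; split=> //.
  have cf1 : cf a b 0%N 0%N = 1 by apply: (mulfI ab); rewrite cf0 mulr1.
  rewrite -wv_pbword -[wv _ _]scale1r -ev_mon; apply: ev_co_eq => a' b' c d am bn cm dn.
  rewrite ev_mon scale1r wv_pbword [RHS]co_pbw // -/(cf a' b' c d).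
  have [/eqP|cd0] := posnP (c + d).
    rewrite addn_eq0 => /andP[/eqP-> /eqP->]; rewrite !eqxx !andbT.
    have := key a b 0 0 a' b' 0 0 m0 n0 m0 n0.
    rewrite cf1 mul1r => ->; rewrite !addn0 m0 n0 !andbT.
    by case: ifP => _; rewrite /kap /= ?mul0n ?expr0 ?cf1 ?mulr1.
  rewrite (deg0 (m + n)%N) ?leq_addr //.
  by move: cd0; case: (c) => [|c']; case: (d) => [|d'] //; rewrite !andbF.
case/eqP: nz; rewrite -[RHS](_ : ev y [::] = 0); last by rewrite /ev evl_nil.
apply: ev_co_eq => a b c d am bn cm dn.
rewrite {2}/ev evl_nil co0 -/(cf a b c d).
have [/eqP|cd0] := posnP (c + d); last by apply: (deg0 (m + n)%N); rewrite ?leq_addr.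
rewrite addn_eq0 => /andP[/eqP-> /eqP->].
by have /negbFE/eqP := none (Ordinal am, Ordinal bn).
Qed.

Lemma skew_primitive_pbw f a0 b0 : (a0 < m)%N -> (b0 < n)%N ->
  ev dy f = t (ev y f) (pbw y a0 b0 0 0) + t 1 (ev y f) ->
  exists p r s, [/\ ev y f = p *: (1 - pbw y a0 b0 0 0) + r *: y gx + s *: y gX,
    r != 0 -> (a0, b0) = (1, 0)%N & s != 0 -> (a0, b0) = (0, 1)%N].
Proof.
move=> am0 bn0 sp; pose cf a b c d := co a b c d (ev y f).
have one : 1 = pbw y 0 0 0 0 by rewrite /pbw !expr0 !mulr1.
have key a1 b1 c1 d1 a2 b2 c2 d2 :
    (c1 < m)%N -> (d1 < n)%N -> (c2 < m)%N -> (d2 < n)%N ->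
    cf a1 b1 c1 d1 * [&& a2 == a0 %[mod m], b2 == b0 %[mod n], c2 == 0 & d2 == 0]%N%:R +
    [&& a1 == 0 %[mod m], b1 == 0 %[mod n], c1 == 0 & d1 == 0]%N%:R * cf a2 b2 c2 d2 =
    if [&& a2 == a1 + c1 %[mod m], b2 == b1 + d1 %[mod n], c1 + c2 < m & d1 + d2 < n]%N
    then kap c1 d1 c2 d2 * cf a1 b1 (c1 + c2)%N (d1 + d2)%N else 0.
  by move=> *; rewrite /cf -co2_delta // sp co2D !co2_t one !co_pbw.
(* Splitting off one [x], or one [X] when [c = 0], leaves two factors of positive degree. Such a
   pairing vanishes on a skew-primitive element, while [kap] does not. *)
have high a b c d : (c < m)%N -> (d < n)%N -> (1 < c + d)%N -> cf a b c d = 0.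
  case: c => [|c] cm dn cd; last first.
    have := key a b 1%N 0%N a.+1 b c d Hm n0 (ltnW cm) dn.
    rewrite addn1 addn0 !eqxx add1n cm add0n dn /= !andbF mul0r addr0 => E.
    have : cf a b 1%N 0%N * [&& a.+1 == a0 %[mod m], b == b0 %[mod n], c == 0 & d == 0]%N%:R = 0.
      by case: (c) cd => [|c']; case: (d) => // *; rewrite !andbF mulr0.
    rewrite E => /eqP; rewrite mulf_eq0 (negPf (kap_neq0 _ _)) //=.
    by move/eqP.
  case: d dn cd => [|[|d]] // dn _.
  have := key a b 0%N 1%N a b.+1 0%N d.+1 m0 Hn m0 (ltnW dn).
  rewrite !addn0 addn1 !eqxx m0 !add1n dn /= !andbF mulr0 mul0r addr0 => /esym/eqP.
  by rewrite mulf_eq0 (negPf (kap_neq0 _ _)) //= => /eqP.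
have kap0 c d : kap 0%N 0%N c d = 1 by rewrite /kap !qbin0 muln0 expr0 !mulr1.
have kap1 c d : kap c d 0%N 0%N = 1 by rewrite /kap !addn0 !qbinn mul0n expr0 !mulr1.
(* Pairing with degree zero on the left: in positive degree only monomials with trivial group-like
   part survive. *)
have supp a b c d : (a < m)%N -> (b < n)%N -> (c < m)%N -> (d < n)%N -> (0 < c + d)%N ->
    ((a, b) != (0, 0)%N) -> cf a b c d = 0.
  move=> am bn cm dn cd ab; have := key a b 0%N 0%N a b c d m0 n0 cm dn.
  rewrite !addn0 !add0n !eqxx cm dn kap0 mul1r /= => <-.
  have -> : [&& c == 0 & d == 0]%N = false by lia.
  rewrite !andbF mulr0 add0r !andbT !modn_small // -xpair_eqE (negPf ab).
  by rewrite mul0r.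
(* Pairing with degree zero on the right: a surviving x^c X^d forces the group-like to be h^c
   H^d. *)
have top c d : (c < m)%N -> (d < n)%N -> (0 < c + d)%N -> cf 0%N 0%N c d != 0 ->
    (a0 == c)%N && (b0 == d).
  move=> cm dn cd nz; have := key 0%N 0%N c d c d 0%N 0%N cm dn m0 n0.
  rewrite !add0n !addn0 !eqxx cm dn kap1 mul1r /=.
  have -> : [&& c == 0 & d == 0]%N = false by lia.
  rewrite mul0r addr0 andbT !modn_small // (eq_sym a0) (eq_sym b0).
  by case: andP => // _; rewrite mulr0 => E; rewrite -E eqxx in nz.
(* Pairing the coordinate of h^a H^b with that of 1 and with itself shows that the degree-zero part
   is a multiple of 1 - g. *)
have deg0 a b : (a < m)%N -> (b < n)%N ->
    cf a b 0%N 0%N = cf 0%N 0%N 0%N 0%N *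
      (((a == 0) && (b == 0))%N%:R - ((a == a0) && (b == b0))%:R).
  move=> am bn; have := key a b 0%N 0%N a b 0%N 0%N m0 n0 m0 n0.
  have := key 0%N 0%N 0%N 0%N a b 0%N 0%N m0 n0 m0 n0.
  rewrite !addn0 !eqxx m0 n0 !kap0 !andbT !mul1r /= !modn_small //.
  case: (boolP ((a == 0) && (b == 0)))%N => [/andP[/eqP-> /eqP->] E _|ab].
    move: E; case: (_ && _); rewrite ?mulr1 ?mulr0 ?subr0 ?mulr1 //.
    by move/eqP; rewrite -subr_eq0 addrK => /eqP->; rewrite mul0r.
  move=> E1 E2; rewrite sub0r mulrN; move/eqP: E1; rewrite addr_eq0 => /eqP E1.
  by rewrite E1 opprK.
exists (cf 0%N 0%N 0%N 0%N), (cf 0%N 0%N 1%N 0%N), (cf 0%N 0%N 0%N 1%N); split; first 1 last.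
- by move/(top 1 0)%N => H; have /andP[/eqP-> /eqP->] := H Hm n0 isT.
- by move/(top 0 1)%N => H; have /andP[/eqP-> /eqP->] := H m0 Hn isT.
set p := cf 0%N 0%N 0%N 0%N; set r := cf 0%N 0%N 1%N 0%N; set s := cf 0%N 0%N 0%N 1%N.
pose F := fscale p (fsub (fone k) (fmon 1 (pbword a0 b0 0 0)))
   ++ fmon r [:: gx] ++ fmon s [:: gX].
have EF : ev y F = p *: (1 - pbw y a0 b0 0 0) + r *: y gx + s *: y gX.
  rewrite !ev_cat ev_scale ev_sub ev_one !ev_mon wv_pbword scale1r.
  by rewrite !wv_cons wv_nil !mulr1 addrA.
rewrite -EF; apply: ev_co_eq => a b c d am bn cm dn; rewrite EF.
have -> : y gx = pbw y 0 0 1 0 by rewrite /pbw !expr0 expr1 !mul1r mulr1.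
have -> : y gX = pbw y 0 0 0 1 by rewrite /pbw !expr0 expr1 !mul1r.
rewrite one !coD !coZ coB !co_pbw // !modn_small // -/(cf a b c d).
have [/eqP|cd] := posnP (c + d).
  rewrite addn_eq0 => /andP[/eqP-> /eqP->]; rewrite !andbT !andbF !mulr0 !addr0.
  by rewrite (deg0 a b).
have -> : [&& c == 0 & d == 0]%N = false by lia.
rewrite !andbF subrr mulr0 add0r.
have [cd1|cd1] := ltnP 1 (c + d).
  rewrite (high a b) //.
  have -> : [&& c == 1 & d == 0]%N = false by lia.
  have -> : [&& c == 0 & d == 1]%N = false by lia.
  by rewrite !andbF !mulr0 addr0.
have [/eqP[-> ->]|ab] := boolP ((a, b) == (0, 0)%N); last first.
  by rewrite (supp a b) // !(andbA (_ == _)) -xpair_eqE (negPf ab) /= !mulr0 addr0.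
case: c d cm dn cd cd1 => [|[|c]] [|[|d]] //= _ _ _ _.
  by rewrite !mulr0 mulr1 add0r.
by rewrite !mulr0 mulr1 addr0.
Qed.

End Model.

(** * Hopf automorphisms *)

(* [phi r s false] sends x to r x and X to s X; [phi r s true] is the former
   composed with the exchange of (h, x) and (H, X). *)
Definition phi (k : fieldType) (r s : k) (b : bool) (i : gen) : falg k :=
  match val i with
  | 0%N => fgen k (if b then gH else gh)
  | 1%N => if b then fmon s [:: gX] else fmon r [:: gx]
  | 2%N => fgen k (if b then gh else gH)
  | _ => if b then fmon r [:: gx] else fmon s [:: gX]
  end.

Arguments phi : simpl never.

Lemma gen_ind (P : gen -> Prop) : P gh -> P gx -> P gH -> P gX -> forall i, P i.
Proof.
move=> Ph Px PH PX [[|[|[|[|//]]]] lt_i].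
- by rewrite (_ : Ordinal _ = gh) //; apply: val_inj.
- by rewrite (_ : Ordinal _ = gx) //; apply: val_inj.
- by rewrite (_ : Ordinal _ = gH) //; apply: val_inj.
- by rewrite (_ : Ordinal _ = gX) //; apply: val_inj.
Qed.

Section Automorphisms.
Variables (k : fieldType) (m n : nat) (q qb sigma lam : k).
Hypotheses (Hm : (1 < m)%N) (Hn : (1 < n)%N).
Hypotheses (Hq : m.-primitive_root q) (Hqb : n.-primitive_root qb).
Hypothesis Hsm : sigma ^+ m = 1.
Variable M : pbw_model m n q qb sigma lam.
Variable R : seq (falg k).
Hypothesis HR : forall f, in_ideal R f <-> in_ideal (rels_gen m n q qb sigma lam) f.

(** What the relations impose on [phi r s b]. For an exchange, xh against XH gives [q = qb], xH
    against hX gives [sigma ^+ 2 = 1], and the relation between x and X gives the condition on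
    [r * s]. *)
Definition allowed (r s : k) (b : bool) : Prop :=
  if b then [/\ q = qb, sigma ^+ 2 = 1 & lam * (sigma * (r * s) + 1) = 0]
  else lam * (r * s - 1) = 0.

Let E := PresBialg R (@dgen_std k) (@egen_std k).
Let y := my M.
Let t := @mt _ _ _ _ _ _ _ M.
Let co := @mco _ _ _ _ _ _ _ M.
Let m0 : (0 < m)%N := ltnW Hm.
Let n0 : (0 < n)%N := ltnW Hn.

Let coD a b c d u v : co a b c d (u + v) = co a b c d u + co a b c d v.
Proof. exact: mcoD. Qed.

Let coZ a b c d z u : co a b c d (z *: u) = z * co a b c d u.
Proof. exact: mcoZ. Qed.

Let coB a b c d u v : co a b c d (u - v) = co a b c d u - co a b c d v.
Proof. by rewrite coD -scaleN1r coZ mulN1r. Qed.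

Let co0 a b c d : co a b c d 0 = 0.
Proof. by rewrite -(scale0r (0 : mA M)) coZ mul0r. Qed.

Let co_pbw a b c d a' b' c' d' :
  (c < m)%N -> (d < n)%N -> (c' < m)%N -> (d' < n)%N ->
  co a b c d (pbw y a' b' c' d') =
    [&& a == a' %[mod m], b == b' %[mod n], c == c' & d == d']%N%:R.
Proof. exact: mco_pbw. Qed.

Lemma in_idealE f : in_ideal R f <-> ev y f = 0.
Proof. by rewrite HR; apply: in_ideal_model Hm Hn Hsm M f. Qed.

Lemma in_ideal_subE f g : in_ideal R (fsub f g) <-> ev y f = ev y g.
Proof.
rewrite in_idealE ev_sub; split=> [/eqP|->]; last exact: subrr.
by rewrite subr_eq0 => /eqP.
Qed.

Lemma preserves_idealP img :
  preserves_ideal E img <-> qrel m n q qb sigma lam (fun i => ev y (img i)).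
Proof.
split=> [pres | rel f].
  apply/rels_genP => r rR; rewrite -ev_fmap; apply/in_idealE/pres/HR.
  exact: in_ideal_gen.
move/HR => fR; apply/in_idealE; rewrite ev_fmap.
by apply: ev_in_ideal fR; apply/rels_genP.
Qed.

Let one_pbw : 1 = pbw y 0 0 0 0. Proof. by rewrite /pbw !expr0 !mulr1. Qed.
Let h_pbw : y gh = pbw y 1 0 0 0. Proof. by rewrite /pbw !expr0 expr1 !mulr1. Qed.
Let H_pbw : y gH = pbw y 0 1 0 0. Proof. by rewrite /pbw !expr0 expr1 !mul1r !mulr1. Qed.
Let x_pbw : y gx = pbw y 0 0 1 0. Proof. by rewrite /pbw !expr0 expr1 !mul1r mulr1. Qed.
Let X_pbw : y gX = pbw y 0 0 0 1. Proof. by rewrite /pbw !expr0 expr1 !mul1r. Qed.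
Let hX_pbw : y gh * y gX = pbw y 1 0 0 1.
Proof. by rewrite /pbw !expr0 !expr1 !mulr1. Qed.
Let hx_pbw : y gh * y gx = pbw y 1 0 1 0.
Proof. by rewrite /pbw !expr0 !expr1 !mulr1. Qed.
Let HX_pbw : y gH * y gX = pbw y 0 1 0 1.
Proof. by rewrite /pbw !expr0 !expr1 !mulr1 mul1r. Qed.
Let Hh_pbw : y gH * y gh = pbw y 1 1 0 0.
Proof. by rewrite /pbw !expr0 !expr1 !mulr1 (qrel_hH (mrel M)). Qed.

Let mod01m : (0 == 1 %[mod m])%N = false. Proof. by rewrite !modn_small. Qed.
Let mod01n : (0 == 1 %[mod n])%N = false. Proof. by rewrite !modn_small. Qed.

Let h_neq_H : y gh != y gH.
Proof.
apply/eqP => /(congr1 (co 1 0 0 0)); rewrite h_pbw H_pbw !co_pbw // !eqxx mod01n /=.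
by rewrite andbF => /eqP; rewrite oner_eq0.
Qed.

Let x_neq0 : y gx != 0.
Proof.
apply/eqP => /(congr1 (co 0 0 1 0)); rewrite x_pbw co0 !co_pbw // !eqxx /=.
by move/eqP; rewrite oner_eq0.
Qed.

Let X_neq0 : y gX != 0.
Proof.
apply/eqP => /(congr1 (co 0 0 0 1)); rewrite X_pbw co0 !co_pbw // !eqxx /=.
by move/eqP; rewrite oner_eq0.
Qed.

Let scale_Hh c : c *: (1 - y gH * y gh) = 0 -> c = 0.
Proof.
move/(congr1 (co 0 0 0 0)); rewrite coZ coB one_pbw Hh_pbw !co_pbw // co0 !eqxx mod01m.
by rewrite /= subr0 mulr1.
Qed.

(** 1 - g commutes with g, whereas [Y] commutes with g only up to the factor [z] different from 1.
    If g is not 1, the coordinate of g - g^2 at g is 1, whence p = z p and p = 0; the coordinate at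
    g x or g X then identifies [z]. *)
Lemma skew_eigen a0 b0 p r s z : (a0 < m)%N -> (b0 < n)%N -> z != 1 ->
  let g := pbw y a0 b0 0 0 in
  let Y := p *: (1 - g) + r *: y gx + s *: y gX in
  (r != 0 -> (a0, b0) = (1, 0)%N) -> (s != 0 -> (a0, b0) = (0, 1)%N) ->
  Y * g = z *: (g * Y) -> Y != 0 ->
  [/\ g = y gh, Y = r *: y gx, r != 0 & z = q] \/
  [/\ g = y gH, Y = s *: y gX, s != 0 & z = qb].
Proof.
move=> am0 bn0 z1 g Y gr gs Yg Y0.
have z1' : 1 - z != 0 by rewrite subr_eq0 eq_sym.
have gg : g * g = pbw y (a0 + a0) (b0 + b0) 0 0.
  rewrite /g /pbw !expr0 !mulr1 !exprD !mulrA -[y gh ^+ a0 * y gH ^+ b0 * _]mulrA.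
  rewrite -(commrX b0 (commr_sym (commrX a0 (commr_sym (qrel_hH (mrel M)))))).
  by rewrite mulrA.
have {}Yg : p *: (g - g * g) + r *: (y gx * g) + s *: (y gX * g)
    = z *: (p *: (g - g * g) + r *: (g * y gx) + s *: (g * y gX)).
  by move: Yg; rewrite /Y !mulrDl !mulrDr -!scalerAl -!scalerAr mulrBl mulrBr mul1r mulr1.
have cogg : (a0, b0) != (0, 0)%N -> co a0 b0 0 0 (g - g * g) = 1.
  move=> ab; rewrite coB gg !co_pbw // !eqxx /= !andbT.
  rewrite -{1}[a0]addn0 -{1}[b0]addn0 !eqn_modDl !modn_small //.
  by rewrite ![(0 == _)%N]eq_sym -xpair_eqE (negPf ab) subr0.
move: (g - g * g) Yg cogg => D Yg cogg.
have pz : p = z * p -> p = 0.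
  move/eqP; rewrite -subr_eq0 -{1}[p]mul1r -mulrBl mulf_eq0 (negPf z1').
  by move/eqP.
have [r0|r0] := eqVneq r 0; last first.
  have [Ea Eb] := gr r0.
  have s0 : s = 0 by apply/eqP; apply: contraTT isT => /gs; rewrite Ea Eb.
  have gh' : g = y gh by rewrite h_pbw /g Ea Eb.
  have gx' : g * y gx = pbw y 1 0 1 0 by rewrite gh' hx_pbw.
  have xg : y gx * g = q *: (g * y gx) by rewrite gh'; exact: qrel_xh (mrel M).
  move: Yg; rewrite s0 !scale0r !addr0 xg gx' => Yg.
  have p0 : p = 0.
    apply: pz; have := congr1 (co a0 b0 0 0) Yg.
    rewrite !(coZ, coD) cogg ?Ea ?Eb // !co_pbw // /= !andbF.
    by rewrite !mulr0 !addr0 !mulr1.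
  left; split=> //; first by rewrite /Y p0 s0 !scale0r add0r addr0.
  have := congr1 (co 1 0 1 0) Yg; rewrite p0 !scale0r !add0r !coZ co_pbw // !eqxx /=.
  by rewrite !mulr1 mulrC => /(mulIf r0).
have [s0|s0] := eqVneq s 0; last first.
  have [Ea Eb] := gs s0.
  have gH' : g = y gH by rewrite H_pbw /g Ea Eb.
  have gX' : g * y gX = pbw y 0 1 0 1 by rewrite gH' HX_pbw.
  have Xg : y gX * g = qb *: (g * y gX) by rewrite gH'; exact: qrel_XH (mrel M).
  move: Yg; rewrite r0 !scale0r !addr0 Xg gX' => Yg.
  have p0 : p = 0.
    apply: pz; have := congr1 (co a0 b0 0 0) Yg.
    rewrite !(coZ, coD) cogg ?Ea ?Eb // !co_pbw // /= !andbF.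
    by rewrite !mulr0 !addr0 !mulr1.
  right; split=> //; first by rewrite /Y p0 r0 !scale0r !add0r.
  have := congr1 (co 0 1 0 1) Yg; rewrite p0 !scale0r !add0r !coZ co_pbw // !eqxx /=.
  by rewrite !mulr1 mulrC => /(mulIf s0).
move: Yg; rewrite r0 s0 !scale0r !addr0 => Yg.
case/eqP: Y0; rewrite /Y r0 s0 !scale0r !addr0.
have [ab|ab] := eqVneq (a0, b0) (0, 0)%N.
  by case: ab => Ea Eb; rewrite /g Ea Eb -one_pbw subrr scaler0.
rewrite pz ?scale0r //.
by have := congr1 (co a0 b0 0 0) Yg; rewrite !coZ cogg // !mulr1.
Qed.

Section EvalPhi.
Variables (A : algType k) (z : gen -> A) (r s : k) (b : bool).

Lemma ev_phi_h : ev z (phi r s b gh) = z (if b then gH else gh).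
Proof. by rewrite /phi /= ev_gen. Qed.

Lemma ev_phi_H : ev z (phi r s b gH) = z (if b then gh else gH).
Proof. by rewrite /phi /= ev_gen. Qed.

Lemma ev_phi_x : ev z (phi r s b gx) = if b then s *: z gX else r *: z gx.
Proof. by rewrite /phi /=; case: b; rewrite ev_mon wv_cons wv_nil mulr1. Qed.

Lemma ev_phi_X : ev z (phi r s b gX) = if b then r *: z gx else s *: z gX.
Proof. by rewrite /phi /=; case: b; rewrite ev_mon wv_cons wv_nil mulr1. Qed.

End EvalPhi.

Definition ev_phiE := (ev_phi_h, ev_phi_H, ev_phi_x, ev_phi_X).

Lemma ev_phi_comp (A : algType k) (z : gen -> A) r s b r' s' b' i :
  ev z (fmap (phi r s b) (phi r' s' b' i)) =
  ev z (phi (r * (if b then s' else r')) (s * (if b then r' else s')) (b (+) b') i).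
Proof.
rewrite ev_fmap; elim/gen_ind: i; rewrite !ev_phiE; case: b; case: b' => /=;
  by rewrite ?ev_phiE // scalerA mulrC.
Qed.

Lemma ev_phi_id (A : algType k) (z : gen -> A) i : ev z (phi 1 1 false i) = z i.
Proof. by elim/gen_ind: i; rewrite !ev_phiE // scale1r. Qed.

Lemma phi_qrel r s b : allowed r s b ->
  qrel m n q qb sigma lam (fun i => ev y (phi r s b i)).
Proof.
have xX := qrel_xX (mrel M).
case: b => /= [[Eq s2 lrs]|lrs].
  have Emn : m = n.
    apply/eqP; rewrite eqn_dvd (prim_order_dvd Hq) Eq prim_expr_order // eqxx.
    by rewrite (prim_order_dvd Hqb) -Eq prim_expr_order // eqxx.
  have Exp (u : mA M) : u ^+ m = u ^+ n by exact: congr1 Emn.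
  case: (mrel M) => hm Hn' xm Xn xh XH xH hX _ hH.
  split; rewrite !ev_phiE -?/y ?exprZn.
  - by rewrite Exp.
  - by rewrite -Exp.
  - by rewrite Exp Xn scaler0.
  - by rewrite -Exp xm scaler0.
  - by rewrite -scalerAl -scalerAr XH !scalerA; congr (_ *: _); rewrite Eq mulrC.
  - by rewrite -scalerAl -scalerAr xh !scalerA; congr (_ *: _); rewrite Eq mulrC.
  - by rewrite -scalerAl -scalerAr hX !scalerA mulrAC -expr2 s2 mul1r.
  - by rewrite -scalerAl -scalerAr xH !scalerA mulrAC -expr2 s2 mul1r.
  - rewrite -!scalerAl -!scalerAr hH.
    (* The relation solved for [X * x]; [sigma] is its own inverse here. *)
    have -> : y gX * y gx = sigma *: (y gx * y gX) - (sigma * lam) *: (1 - y gH * y gh).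
      by rewrite -scalerA -xX scalerBr opprB addrC subrK scalerA -expr2 s2 scale1r.
    rewrite !scalerBr !scalerA addrAC -scalerBl (_ : s * r * sigma - _ = 0); last by ring.
    rewrite scale0r add0r -!scalerBr -scaleNr; congr (_ *: _).
    by move/eqP: lrs; rewrite mulrDr mulr1 addrC addr_eq0 => /eqP Elam; rewrite [RHS]Elam; ring.
  - by rewrite hH.
case: (mrel M) => hm Hn' xm Xn xh XH xH hX _ hH.
split; rewrite !ev_phiE -?/y ?exprZn //.
- by rewrite xm scaler0.
- by rewrite Xn scaler0.
- by rewrite -scalerAl -scalerAr xh !scalerA mulrC.
- by rewrite -scalerAl -scalerAr XH !scalerA mulrC.
- by rewrite -scalerAl -scalerAr xH !scalerA mulrC.
- by rewrite -scalerAl -scalerAr hX !scalerA mulrC.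
- rewrite -!scalerAl -!scalerAr !scalerA.
  transitivity ((r * s) *: (y gx * y gX - sigma *: (y gX * y gx))).
    by rewrite scalerBr !scalerA; congr (_ - _ *: _); ring.
  rewrite xX scalerA; congr (_ *: _).
  by move/eqP: lrs; rewrite mulrBr mulr1 subr_eq0 mulrC => /eqP.
Qed.

(** [phi] carries each pair of a group-like and its skew-primitive to such a pair up to scalars, so
    no relation enters. With [fdelta_fmap], the difference to be placed in the tensor ideal is zero
    already in the free tensor square. *)
Lemma phi_delta r s b i :
  feq2 (fdelta (@dgen_std k) (phi r s b i)) (fmap2 (phi r s b) (dgen_std k i)).
Proof.
apply: evl2_feq2 => F; rewrite evl2_fdelta evl2_fmap2.
by elim/gen_ind: i; case: b;
  rewrite /evl /evl2 /= ?(big_cons, big_nil) /= /GRing.scale /=; ring.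
Qed.

Lemma fepsE (e : gen -> k) f : feps e f = ev (e : gen -> k^o) f.
Proof. by []. Qed.

Lemma phi_hopf_aut r s b : r != 0 -> s != 0 -> allowed r s b -> is_hopf_aut E (phi r s b).
Proof.
move=> r0 s0 ok; split; first split.
- exact/preserves_idealP/phi_qrel.
- move=> f; exists [::]; split=> //; apply: evl2_feq2 => F.
  rewrite evl2_sub (feq2_evl2 F (fdelta_fmap _ (phi_delta r s b))) subrr.
  by rewrite /evl2 big_nil.
- move=> f; rewrite !fepsE ev_fmap; apply: (@eq_ev k k^o) => i.
  by elim/gen_ind: i; rewrite !ev_phiE; case: b {ok}; rewrite /egen_std //= scaler0.
(* For an exchange, [ev_phi_comp] asks for r s' = s r' = 1, so the inverse scalars trade places. *)
pose r' := if b then s^-1 else r^-1; pose s' := if b then r^-1 else s^-1.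
exists (phi r' s' b); split.
- apply/preserves_idealP/phi_qrel; rewrite {}/r' {}/s'.
  case: b ok => /= [[Eq s2 lrs]|lrs].
    have [->|lam0] := eqVneq lam 0; first by rewrite !mul0r.
    split=> //; move/eqP: lrs; rewrite mulf_eq0 (negPf lam0) addr_eq0 /= => /eqP rs.
    (* Squaring sigma r s = -1 gives (r s)^2 = 1. *)
    suff -> : s^-1 * r^-1 = r * s by rewrite rs addNr mulr0.
    rewrite -invfM mulrC; apply: (mulfI (mulf_neq0 r0 s0)); rewrite mulfV ?mulf_neq0 //.
    have := congr1 (fun u => u ^+ 2) rs.
    by rewrite exprMn s2 mul1r sqrrN expr1n expr2 => ->.
  have [->|lam0] := eqVneq lam 0; first by rewrite !mul0r.
  move/eqP: lrs; rewrite mulf_eq0 (negPf lam0) subr_eq0 /= => /eqP rs.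
  by rewrite -invfM mulrC mulrC rs invr1 subrr mulr0.
- move=> i; apply/in_ideal_subE; rewrite ev_phi_comp ev_gen addbb -[RHS]ev_phi_id.
  by rewrite {}/r' {}/s'; case: b {ok}; rewrite !mulVf.
- move=> i; apply/in_ideal_subE; rewrite ev_phi_comp ev_gen addbb -[RHS]ev_phi_id.
  by rewrite {}/r' {}/s'; case: b {ok}; rewrite !mulfV.
Qed.

Lemma hopf_aut_phi img : is_hopf_aut E img -> exists r s b,
  [/\ r != 0, s != 0, allowed r s b & forall i, ev y (img i) = ev y (phi r s b i)].
Proof.
case=> -[pres del _] [img' [pres' imgK _]].
pose y' i := ev y (img i).
have rel : qrel m n q qb sigma lam y' by apply/preserves_idealP.
have yR r : r \in R -> ev y r = 0 by move/in_ideal_gen/in_idealE.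
have dimg i : ev (fun j => evt t y (dgen_std k j)) (img i) = evt t y' (dgen_std k i).
  have := evt_in_tideal (@mtDl _ _ _ _ _ _ _ M) (@mtDr _ _ _ _ _ _ _ M)
    (@mtZl _ _ _ _ _ _ _ M) (@mtZr _ _ _ _ _ _ _ M) yR (del (fgen k i)).
  rewrite evt_sub (evt_fdelta (@mtM _ _ _ _ _ _ _ M) (mt11 M)).
  rewrite (evt_fmap2 (@mtDl _ _ _ _ _ _ _ M) (@mtDr _ _ _ _ _ _ _ M)
    (@mtZl _ _ _ _ _ _ _ M) (@mtZr _ _ _ _ _ _ _ M)).
  rewrite (evt_fdelta (@mtM _ _ _ _ _ _ _ M) (mt11 M)) ev_fmap !ev_gen.
  by move/eqP; rewrite subr_eq0 => /eqP.
(* The inverse map, evaluated in the model, supplies the injectivity of the automorphism. *)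
have img_inj f g : ev y f = ev y g -> ev (fun i => ev y (img' i)) f = ev (fun i => ev y (img' i)) g.
  move/in_ideal_subE/pres'/in_idealE; rewrite ev_fmap ev_sub => /eqP.
  by rewrite subr_eq0 => /eqP.
have y'K i : ev (fun j => ev y (img' j)) (img i) = y i.
  by have /in_ideal_subE := imgK i; rewrite ev_fmap ev_gen.
have y'_neq0 i : y i != 0 -> y' i != 0.
  apply: contraNneq => yi; rewrite -y'K.
  by rewrite (img_inj (img i) [::]) ?[ev _ [::]]evl_nil.
have grp i : (exists2 j, (0 < j)%N & y' i ^+ j = 1) ->
    evt t y' (dgen_std k i) = t (y' i) (y' i) ->
    exists a b, [/\ (a < m)%N, (b < n)%N & y' i = pbw y a b 0 0].
  move=> [j j0 yj] di; apply: (group_like_pbw Hm Hn Hq Hqb Hsm).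
    by rewrite dimg di.
  apply: contraTneq (oner_neq0 (mA M)) => yi0.
  by rewrite -yj /y' yi0 expr0n gtn_eqF // eqxx.
have skew i g z : z != 1 -> (exists a b, [/\ (a < m)%N, (b < n)%N & g = pbw y a b 0 0]) ->
    evt t y' (dgen_std k i) = t (y' i) g + t 1 (y' i) -> y' i * g = z *: (g * y' i) ->
    y' i != 0 -> exists2 r, r != 0 &
    [/\ g = y gh, y' i = r *: y gx & z = q] \/ [/\ g = y gH, y' i = r *: y gX & z = qb].
  move=> z1 [a [b [am bn ->]]] di; rewrite -dimg in di.
  have [p [r [s [Ei gr gs]]]] := skew_primitive_pbw Hm Hn Hq Hqb Hsm am bn di.
  rewrite -/(y' i) in Ei; rewrite Ei => Yg Y0.
  have [[-> -> r0 ->]|[-> -> s0 ->]] := skew_eigen am bn z1 gr gs Yg Y0.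
    by exists r => //; left.
  by exists s => //; right.
have gh_grp : exists a b, [/\ (a < m)%N, (b < n)%N & y' gh = pbw y a b 0 0].
  by apply: grp; [exists m; rewrite ?(qrel_hm rel) | exact: dy_h].
have gH_grp : exists a b, [/\ (a < m)%N, (b < n)%N & y' gH = pbw y a b 0 0].
  by apply: grp; [exists n; rewrite ?(qrel_Hn rel) | exact: dy_H].
have hH : y' gh != y' gH.
  by apply: contraNneq h_neq_H => /img_inj; rewrite !y'K => ->.
have [r r0 Hx] := skew gx _ _ (prim_neq1 Hm Hq) gh_grp (dy_x _ _)
  (qrel_xh rel) (y'_neq0 _ x_neq0).
have [s s0 HX] := skew gX _ _ (prim_neq1 Hn Hqb) gH_grp (dy_X _ _)
  (qrel_XH rel) (y'_neq0 _ X_neq0).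
have := qrel_xX rel; have := qrel_xH rel.
case: Hx => -[Eh Ex Eq]; case: HX => -[EH EX EQ].
- by rewrite Eh EH eqxx in hH.
- rewrite Eh EH Ex EX -!scalerAl -!scalerAr => _ xX'.
  exists r, s, false; split=> //; last by elim/gen_ind; rewrite !ev_phiE.
  have key : (r * s) *: (lam *: (1 - y gH * y gh)) = lam *: (1 - y gH * y gh).
    rewrite -[RHS]xX' -(qrel_xX (mrel M)) -/y scalerBr !scalerA.
    by congr (_ - _ *: _); ring.
  by apply: scale_Hh; rewrite mulrBr mulr1 scalerBl mulrC -scalerA key subrr.
- rewrite Eh EH Ex EX -!scalerAl -!scalerAr => xH' xX'.
  have s2 : sigma ^+ 2 = 1.
    have sg0 : sigma != 0 := sigma_neq0 Hm Hsm.
    have Xh : y gX * y gh = sigma^-1 *: (y gh * y gX).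
      by rewrite (qrel_hX (mrel M)) scalerA mulVf // scale1r.
    (* The image of the relation between x and H is X h = sigma h X; against h X = sigma X h, the
       coordinate at h X gives sigma^-1 = sigma. *)
    move: xH' => /(congr1 (co 1 0 0 1)).
    rewrite Xh !coZ hX_pbw co_pbw // !eqxx /= !mulr1 [RHS]mulrC => /(mulfI r0) ss.
    by rewrite expr2 -{1}ss mulVf.
  (* The scalars are swapped because [r] comes from the image of x, which is now a multiple of X. *)
  exists s, r, true; split=> //; last by elim/gen_ind; rewrite !ev_phiE.
  have key : - (sigma * (s * r)) *: (lam *: (1 - y gH * y gh)) = lam *: (1 - y gH * y gh).
    rewrite -{2}(qrel_hH (mrel M)) -/y -[RHS]xX' -(qrel_xX (mrel M)) -/y scalerBr !scalerA.
    rewrite [RHS]addrC -!scaleNr; congr (_ *: _ + _ *: _); first by ring.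
    by transitivity (sigma ^+ 2 * (r * s)); [ring | rewrite s2 mul1r].
  split=> //; apply: scale_Hh; rewrite mulrDr mulr1 scalerDl mulrC -scalerA.
  by rewrite -[X in _ + X]key scaleNr subrr.
- by rewrite Eh EH eqxx in hH.
Qed.

Lemma phi_inj r s b r' s' b' : (forall i, ev y (phi r s b i) = ev y (phi r' s' b' i)) ->
  [/\ r = r', s = s' & b = b'].
Proof.
have scaleI (u : mA M) c c' : u != 0 -> c *: u = c' *: u -> c = c'.
  move=> u0 /eqP; rewrite -subr_eq0 -scalerBl scaler_eq0 (negPf u0) orbF subr_eq0.
  by move/eqP.
move=> eqi; have Eb : b = b'.
  have := eqi gh; rewrite !ev_phiE; case: b {eqi}; case: b' => // /eqP.
    by rewrite eq_sym (negPf h_neq_H).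
  by rewrite (negPf h_neq_H).
move: (eqi gx) (eqi gX); rewrite -Eb !ev_phiE; case: b {eqi Eb}.
  by move=> /(scaleI _ _ _ X_neq0) -> /(scaleI _ _ _ x_neq0) ->.
by move=> /(scaleI _ _ _ x_neq0) -> /(scaleI _ _ _ X_neq0) ->.
Qed.

(** By [ev_phi_comp] the maps [phi] compose as [kkz_mul] prescribes. Each group of the theorem is
    therefore embedded by [psi] in that semidirect product, with the allowed triples as its exact
    image. *)
Lemma aut_group_iso_phi (G : Type) (mulG : G -> G -> G)
    (psi : G -> kstar k * kstar k * bool) :
  injective psi -> {morph psi : g g' / mulG g g' >-> kkz_mul g g'} ->
  (forall u, allowed (val u.1.1) (val u.1.2) u.2 <-> exists g, psi g = u) ->
  aut_group_iso E mulG.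
Proof.
move=> psi_inj psiM psi_ok.
exists (fun g => phi (val (psi g).1.1) (val (psi g).1.2) (psi g).2); split.
- move=> g; apply: phi_hopf_aut; [exact: (valP (psi g).1.1) | exact: (valP (psi g).1.2) |].
  by apply/psi_ok; exists g.
- move=> g g' i; apply/in_ideal_subE; rewrite ev_phi_comp psiM.
  by case: (psi g) (psi g') => [[r s] []] [[r' s'] b'].
- move=> g g' eqg; apply: psi_inj.
  have [|Er Es Eb] := @phi_inj (val (psi g).1.1) (val (psi g).1.2) (psi g).2
    (val (psi g').1.1) (val (psi g').1.2) (psi g').2.
    by move=> i; apply/in_ideal_subE.
  move: Er Es Eb; case: (psi g) (psi g') => [[r s] b] [[r' s'] b'] /=.
  by move=> /val_inj -> /val_inj -> ->.
- move=> img /hopf_aut_phi[r [s [b [r0 s0 ok eqi]]]].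
  have [g Eg] := proj1 (psi_ok (Sub r r0, Sub s s0, b)) ok.
  by exists g => i; apply/in_ideal_subE; rewrite Eg.
Qed.

End Automorphisms.

(** * The two families and their automorphism groups *)

Lemma T_ideal (k : fieldType) (m n : nat) (q qb sigma : k) f :
  in_ideal (rels_T sigma qb q n m) f <-> in_ideal (rels_gen m n q qb sigma 0) f.
Proof.
have feq9 : feq (fsub (fsub (fmon 1 [:: gx; gX]) (fmon sigma [:: gX; gx]))
      (fscale 0 (fsub (fone k) (fmon 1 [:: gH; gh]))))
    (fsub (fmon 1 [:: gx; gX]) (fmon sigma [:: gX; gx])).
  by apply: evl_feq => F; rewrite evl_sub evl_scale scale0r subr0.
split; apply: in_ideal_incl => r; rewrite !inE.
- do 8?case/predU1P => [->|]; try by apply: in_ideal_gen; rewrite !inE eqxx ?orbT.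
  case/predU1P => [->|/eqP->]; last by apply: in_ideal_gen; rewrite !inE eqxx ?orbT.
  by apply: in_ideal_feq feq9 _; apply: in_ideal_gen; rewrite !inE eqxx ?orbT.
- do 8?case/predU1P => [->|]; try by apply: in_ideal_gen; rewrite !inE eqxx ?orbT.
  case/predU1P => [->|/eqP->]; last by apply: in_ideal_gen; rewrite !inE eqxx ?orbT.
  apply: (in_ideal_feq (f := fsub (fmon 1 [:: gx; gX]) (fmon sigma [:: gX; gx]))).
    by move=> w; rewrite feq9.
  by apply: in_ideal_gen; rewrite !inE eqxx ?orbT.
Qed.

Lemma Q_ideal (k : fieldType) (n : nat) (q : k) f :
  in_ideal (rels_Q n q) f <-> in_ideal (rels_gen n n q (q ^+ n.-1) q 1) f.
Proof.
suff -> : rels_gen n n q (q ^+ n.-1) q 1 = rels_Q n q by [].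
by rewrite /rels_gen /fscale /= !mul1r.
Qed.

Lemma T_aut_group_iso (k : fieldType) (m n : nat) (q qb sigma : k) (G : Type)
    (mulG : G -> G -> G) (psi : G -> kstar k * kstar k * bool) :
  (1 < m)%N -> (1 < n)%N -> m.-primitive_root q -> n.-primitive_root qb ->
  sigma ^+ m = 1 -> sigma ^+ n = 1 ->
  injective psi -> {morph psi : g g' / mulG g g' >-> kkz_mul g g'} ->
  (forall u : kstar k * kstar k * bool,
     (u.2 -> q = qb /\ sigma ^+ 2 = 1) <-> exists g, psi g = u) ->
  aut_group_iso (T_alg sigma n m qb q) mulG.
Proof.
move=> Hm Hn Hq Hqb Hsm Hsn psi_inj psiM psi_ok.
have [|M] := regular_model (lam := 0) Hm Hn Hq Hqb Hsm Hsn; first by rewrite eqxx.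
apply: (aut_group_iso_phi Hm Hn Hq Hqb Hsm M (@T_ideal _ _ _ _ _ _) psi_inj psiM).
move=> u; rewrite -psi_ok /allowed !mul0r; case: u.2; split=> //.
- by case.
- by case/(_ isT).
Qed.

(** With [sigma = q] and [qb = q^-1] an exchange requires q^2 = 1, that is n = 2 and q = -1; then
    sigma r s = -1 reads r s = 1, the same condition as without exchange. *)
Lemma Q_aut_group_iso (k : fieldType) (n : nat) (q : k) (G : Type)
    (mulG : G -> G -> G) (psi : G -> kstar k * kstar k * bool) :
  (1 < n)%N -> n.-primitive_root q ->
  injective psi -> {morph psi : g g' / mulG g g' >-> kkz_mul g g'} ->
  (forall u : kstar k * kstar k * bool,
     val u.1.1 * val u.1.2 = 1 /\ (u.2 -> n = 2%N) <-> exists g, psi g = u) ->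
  aut_group_iso (Q_alg n q) mulG.
Proof.
move=> Hn Hq psi_inj psiM psi_ok; have n0 := ltnW Hn.
have qn : q ^+ n = 1 := prim_expr_order Hq.
have q0 : q != 0.
  by apply: contraTneq (oner_neq0 k) => q_0; rewrite -qn q_0 expr0n gtn_eqF // eqxx.
have Eqb : q ^+ n.-1 = q^-1.
  by apply: (mulfI q0); rewrite -exprS prednK // qn mulfV.
have Hqb : n.-primitive_root (q ^+ n.-1).
  by rewrite prim_root_exp_coprime // coprimePn.
have [|M] := regular_model (lam := 1) Hn Hn Hq Hqb qn qn; first by [].
apply: (aut_group_iso_phi Hn Hn Hq Hqb qn M (@Q_ideal _ _ _) psi_inj psiM).
move=> u; rewrite -psi_ok /allowed !mul1r.
have q2n : q ^+ 2 = 1 <-> n = 2%N.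
  split=> [/eqP | <- //]; rewrite -(prim_order_dvd Hq) => /dvdn_leq; lia.
have q2N1 : q ^+ 2 = 1 -> q = -1.
  move/eqP; rewrite -[X in _ == X](expr1n k 2) eqf_sqr (negPf (prim_neq1 Hn Hq)).
  by move/eqP.
case: u.2; last first.
  split=> [/eqP|[-> _]]; last by rewrite subrr.
  by rewrite subr_eq0 => /eqP.
split=> [[_ q2 /eqP]|[-> /(_ isT)/q2n q2]].
  rewrite (q2N1 q2) mulN1r addrC subr_eq0 eq_sym => /eqP.
  by split=> // _; apply/q2n.
by split=> //; rewrite ?Eqb (q2N1 q2) ?invrN1 // mulr1 addNr.
Qed.

Theorem theorem2p6 (k : fieldType) (Hchar : [pchar k] =i pred0)
  (m n : nat) (Hm : (1 < m)%N) (Hn : (1 < n)%N) (q qb : k)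
  (Hq : m.-primitive_root q) (Hqb : n.-primitive_root qb) :
  let d := gcdn m n in
  (* (1) *)
  ((m != n ->
      forall sigma : k, sigma ^+ d = 1 ->
        aut_group_iso (T_alg sigma n m qb q) (@kk_mul k)) /\
   (m = n -> q != qb ->
      forall sigma : k, sigma ^+ n = 1 ->
        aut_group_iso (T_alg sigma n n qb q) (@kk_mul k))) /\
  (* (2) *)
  (m = n ->
     forall sigma : k, sigma ^+ n = 1 ->
       (sigma ^+ 2 != 1 -> aut_group_iso (T_alg sigma n n q q) (@kk_mul k)) /\
       (sigma ^+ 2 = 1 -> aut_group_iso (T_alg sigma n n q q) (@kkz_mul k))) /\
  (* (3) *)
  (m = n ->
     ((3 <= n)%N -> aut_group_iso (Q_alg n q) (@kmul k)) /\
     (n = 2%N -> aut_group_iso (Q_alg n q) (@kz_mul k))).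
Proof.
have noswap qb' sigma m' : (1 < m')%N -> m'.-primitive_root q -> n.-primitive_root qb' ->
    sigma ^+ m' = 1 -> sigma ^+ n = 1 -> ~ (q = qb' /\ sigma ^+ 2 = 1) ->
    aut_group_iso (T_alg sigma n m' qb' q) (@kk_mul k).
  move=> Hm' Hq' Hqb' sm sn no.
  apply: (T_aut_group_iso (psi := fun u => (u, false))) => //.
    by move=> u v [].
  move=> [u b]; split=> /= [no_b|[g [_ <-]] //].
  by exists u; case: b no_b => [/(_ isT)/no|].
move=> d; split; [split|split].
- move=> mn sigma sd; apply: noswap => //.
  + by rewrite -(divnK (dvdn_gcdl m n)) mulnC exprM sd expr1n.
  + by rewrite -(divnK (dvdn_gcdr m n)) mulnC exprM sd expr1n.
  case=> Eq _; case/eqP: mn; apply/eqP; rewrite eqn_dvd (prim_order_dvd Hq) Eq.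
  by rewrite prim_expr_order // (prim_order_dvd Hqb) -Eq prim_expr_order // eqxx.
- move=> Emn qqb sigma sn; rewrite Emn in Hq; apply: noswap => //.
  by case=> Eq; rewrite Eq eqxx in qqb.
- move=> Emn sigma sn; rewrite Emn in Hq; split=> s2.
    by apply: noswap => // -[_ /eqP]; rewrite (negPf s2).
  apply: (T_aut_group_iso (psi := id)) => //.
  by move=> u; split=> // _; exists u.
move=> Emn; rewrite Emn in Hq; split=> n3.
  apply: (Q_aut_group_iso (psi := fun a => (a, kinv a, false))) => //.
  - by move=> a b [].
  - move=> a b; congr (_, _, _); apply: val_inj => /=; exact: invfM.
  move=> [[r s] b]; split=> /= [[rs bn]|[a [<- <- <-]]]; last first.
    by split=> //=; rewrite mulfV //; exact: valP a.
  exists r; case: b bn => [/(_ isT) n2|_]; first by rewrite n2 in n3.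
  by congr (_, _, _); apply: val_inj => /=; apply: (mulfI (valP r)); rewrite rs mulfV // (valP r).
(* On pairs [(a, kinv a)] the swap [tau] inverts the first component, which is [kappa]. *)
apply: (Q_aut_group_iso (psi := fun a => (a.1, kinv a.1, a.2))) => //.
- by move=> [a b] [a' b'] [-> _ ->].
- move=> [a b] [a' b']; rewrite /kkz_mul /kz_mul /kk_mul /=; congr (_, _, _).
    by case: b.
  apply: val_inj => /=; rewrite invfM; congr (_ * _).
  by case: b => //=; rewrite invrK.
move=> [[r s] b]; split=> /= [[rs _]|[[a b'] /= [<- <- _]]]; last first.
  by split=> //=; rewrite mulfV //; exact: valP a.
exists (r, b).
by congr (_, _, _); apply: val_inj => /=; apply: (mulfI (valP r)); rewrite rs mulfV // (valP r).
Qed.
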